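(* Let $I$ be an inner function, let $n\ge 0$ be an integer, and let $b=\frac{I^n(1+I)}{2}$. Then the following orthogonal decomposition of the de Branges-Rovnyak space $\mathcal{H}(b)$ holds: $$\mathcal{H}(b)=(1-I)H^2\oplus_b(2+2I+\ldots+2I^{n-1}+I^n)K_I .$$
   Context: $\mathbb{D}$ is the open unit disk, $\mathbb{T}=\partial\mathbb{D}$, and $H^2$ is the Hardy space on $\mathbb{D}$ with norm $\|\cdot\|$, identified via boundary values with a closed subspace of $L^2(\mathbb{T})$. For $\varphi\in L^\infty(\mathbb{T})$ the Toeplitz operator on $H^2$ is $T_\varphi f=P(\varphi f)$, where $P$ is the orthogonal projection of $L^2(\mathbb{T})$ onto $H^2$. For $b$ in the closed unit ball of $H^\infty$, the de Branges-Rovnyak space $\mathcal{H}(b)$ is the image of $H^2$ under $(1-T_bT_{\overline b})^{1/2}$, with the range norm defined by $\|(1-T_bT_{\overline b})^{1/2}f\|_b=\|f\|$ for $f\in(\ker(1-T_bT_{\overline b})^{1/2})^\perp$; it is a Hilbert space. For an inner function $I$, $K_I=H^2\ominus IH^2$ is the model space. For a function $g$ and a set $X$ of functions, $gX=\{gh: h\in X\}$. The symbol $\oplus_b$ denotes the orthogonal direct sum in the Hilbert space $\mathcal{H}(b)$. For $n=0$ the polynomial $2+2I+\ldots+2I^{n-1}+I^n$ is the constant $1$ (and for $n=1$ it is $2+I$). *)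

(* Defs.v *)
From HB Require Import structures.
From mathcomp Require Import all_boot all_order all_algebra.
From mathcomp Require Import generic_quotient ring_quotient.
From mathcomp Require Import all_classical all_reals all_analysis.
From mathcomp Require Import complex.

Set Implicit Arguments.
Unset Strict Implicit.
Unset Printing Implicit Defensive.

Import Order.TTheory GRing.Theory Num.Theory.
Import numFieldNormedType.Exports.

Local Open Scope classical_set_scope.
Local Open Scope ring_scope.
Local Open Scope complex_scope.
Local Open Scope quotient_scope.

(* A function F on the unit circle is represented by t |-> F (exp (2 i pi t));
   only the values on [0, 1[ matter, and [circle_measure] then corresponds to
   the normalized arc length measure. *)
Definition circle_measure (R : realType) :
    {measure set (measurableTypeR R) -> \bar R} :=
  mrestr (@lebesgue_measure R) (measurable_itv `[(0 : R), 1[).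

Section L2.
Context (R : realType).
Local Notation m := (@circle_measure R).

Definition cLfun (p : \bar R) : {pred R -> R[i]} :=
  [pred f | ((fun t => complex.Re (f t)) \in Lfun m p) &&
            ((fun t => complex.Im (f t)) \in Lfun m p)].

Lemma cLfun_submod_closed p : (1 <= p)%E -> submod_closed (cLfun p).
Proof.
move=> p1; have [L0 LD] := @Lfun_submod_closed _ _ _ m p p1.
split; first by rewrite inE /=; apply/andP; split; exact: L0.
move=> a f g; rewrite !inE => /andP[f1 f2] /andP[g1 g2].
have LZ c h : h \in Lfun m p -> c *: h \in Lfun m p.
  by move=> hL; rewrite -[_ *: _]addr0; exact: LD.
apply/andP; split.
- rewrite (_ : (fun t => _) = complex.Re a *: (fun t => complex.Re (f t)) +
    (- complex.Im a *: (fun t => complex.Im (f t)) + (fun t => complex.Re (g t)))).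
    by apply: (LD) => //; exact: (LD).
  apply/funext => t; rewrite !fctE.
  by case: a (f t) (g t) => [a b] [c d] [e k] /=; rewrite -[X in _ = _ + (X + _)]/(- b * d) mulNr addrA.
- rewrite (_ : (fun t => _) = complex.Re a *: (fun t => complex.Im (f t)) +
    (complex.Im a *: (fun t => complex.Re (f t)) + (fun t => complex.Im (g t)))).
    by apply: (LD) => //; exact: (LD).
  apply/funext => t; rewrite !fctE.
  by case: a (f t) (g t) => [a b] [c d] [e k] /=; rewrite addrA.
Qed.

Definition cLfun2 : {pred R -> R[i]} := cLfun 2%:E.

Lemma cLfun2_submod_closed : submod_closed cLfun2.
Proof. by apply: cLfun_submod_closed; rewrite lee_fin ler1n. Qed.

HB.instance Definition _ :=
  GRing.isSubmodClosed.Build R[i] (R -> R[i]) cLfun2 cLfun2_submod_closed.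

Record preL2 := PreL2 { preL2_fun :> R -> R[i]; _ : preL2_fun \in cLfun2 }.

HB.instance Definition _ := [isSub for preL2_fun].
HB.instance Definition _ := [Choice of preL2 by <:].
HB.instance Definition _ := [SubChoice_isSubLmodule of preL2 by <:].

Definition ae_null : {pred preL2} := fun f => `[< {ae m, forall t, f t = 0} >].

Lemma ae_nullZ a f : f \in ae_null -> a *: f \in ae_null.
Proof.
move=> /asboolP f0; apply/asboolP.
apply: (@filterS _ _ (ae_filter_ringOfSetsType m) _ _ _ f0) => t ft0.
by rewrite -[LHS]/(a *: f t) ft0 scaler0.
Qed.

Lemma ae_null_zmod_closed : zmod_closed ae_null.
Proof.
split.
  by apply/asboolP; apply: (@nearW _ _ _ (ae_filter_ringOfSetsType m)).
move=> f g /asboolP f0 /asboolP g0; apply/asboolP.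
apply: (@filterS2 _ _ (ae_filter_ringOfSetsType m) _ _ _ _ f0 g0) => t ft0 gt0.
by rewrite -[LHS]/(f t - g t) ft0 gt0 subrr.
Qed.

HB.instance Definition _ :=
  GRing.isZmodClosed.Build preL2 ae_null ae_null_zmod_closed.

Definition L2 := {ideal_quot ae_null}.
HB.instance Definition _ := Choice.on L2.
HB.instance Definition _ := GRing.Zmodule.on L2.
HB.instance Definition _ := ZmodQuotient.on L2.

Definition L2_scale (a : R[i]) : L2 -> L2 := lift_op1 L2 ( *:%R a).

Lemma pi_L2Z a : {morph \pi_L2 : f / a *: f >-> L2_scale a f}.
Proof.
move=> f; unlock L2_scale; apply/eqP; rewrite piE Quotient.equivE -scalerBr.
by apply: ae_nullZ; rewrite Quotient.idealrBE reprK.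
Qed.
Canonical pi_L2Z_morph a := PiMorph1 (pi_L2Z a).

Lemma L2_scaleA a b f : L2_scale a (L2_scale b f) = L2_scale (a * b) f.
Proof. by rewrite -[f]reprK !piE scalerA. Qed.

Lemma L2_scale1 : left_id 1 L2_scale.
Proof. by move=> f; rewrite -[f]reprK !piE scale1r. Qed.

Lemma L2_scaleDr : right_distributive L2_scale +%R.
Proof. by move=> a f g; rewrite -[f]reprK -[g]reprK !piE scalerDr. Qed.

Lemma L2_scaleDl f : {morph L2_scale^~ f : a b / a + b}.
Proof. by move=> a b; rewrite -[f]reprK !piE scalerDl. Qed.

HB.instance Definition _ := GRing.Zmodule_isLmodule.Build R[i] L2
  L2_scaleA L2_scale1 L2_scaleDr L2_scaleDl.
End L2.

Section Hilbert.
Context (R : realType).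
Local Notation m := (@circle_measure R).
Local Notation L2 := (L2 R).
Implicit Types (F phi : R -> R[i]) (f g h : L2) (H E : set L2).

Definition cintegral F : R[i] :=
  (\int[m]_t complex.Re (F t)) +i* (\int[m]_t complex.Im (F t)).

Definition fourier_mode (k : int) (t : R) : R[i] :=
  cos (2 * pi * k%:~R * t) +i* sin (2 * pi * k%:~R * t).

Definition fourier_coef F (k : int) : R[i] :=
  cintegral (fun t => F t * (fourier_mode k t)^*).

Definition L2_fun f : R -> R[i] := preL2_fun (repr f).

Definition inner f g : R[i] := cintegral (fun t => L2_fun f t * (L2_fun g t)^*).

Definition L2_norm f : R := Num.sqrt (complex.Re (inner f f)).

(* The default value 0 is returned when phi f is not square integrable; this
   does not happen for phi in L^oo. *)
Definition mult phi f : L2 :=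
  \pi_L2 (insubd (0 : preL2 R) (fun t => phi t * L2_fun f t)).

Definition mult_set phi E : set L2 := mult phi @` E.

(* The Hardy space, identified with the closed subspace of its boundary
   functions in L^2. *)
Definition H2 : set L2 :=
  [set f | forall k : int, k < 0 -> fourier_coef (L2_fun f) k = 0].

(* The boundary functions of the elements of H^oo. *)
Definition Hinf : set (R -> R[i]) :=
  [set F | F \in cLfun +oo%E /\ forall k : int, k < 0 -> fourier_coef F k = 0].

Definition inner_function F := Hinf F /\ {ae m, forall t, `|F t| = 1}.

Definition orth_compl H E : set L2 :=
  [set f | H f /\ forall g, E g -> inner f g = 0].

Definition orth_proj H f : L2 :=
  xget 0 [set g | H g /\ forall h, H h -> inner (f - g) h = 0].

Definition toeplitz phi f : L2 := orth_proj H2 (mult phi f).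

Definition model_space F : set L2 := orth_compl H2 (mult_set F H2).

(* An operator on a closed subspace H is represented by a function on L2 of
   which only the values on H matter. *)
Definition bounded_operator H (A : L2 -> L2) :=
  [/\ forall f, H f -> H (A f),
      forall (a : R[i]) f g, H f -> H g -> A (a *: f + g) = a *: A f + A g &
      exists M : R, forall f, H f -> L2_norm (A f) <= M * L2_norm f].

(* For x in R[i], 0 <= x means that x is real and nonnegative. *)
Definition positive_operator H (A : L2 -> L2) :=
  bounded_operator H A /\ forall f, H f -> 0 <= inner (A f) f.

(* The positive square root of D on H; it exists and is unique on H as soon as
   D is a positive operator on H. *)
Definition sqrt_operator H (D : L2 -> L2) : L2 -> L2 :=
  xget (fun=> 0) [set A : L2 -> L2 | positive_operator H A /\
                                      forall f, H f -> A (A f) = D f].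

(* Meant for b in the closed unit ball of H^oo, given by its boundary values. *)
Section deBrangesRovnyak.
Variable b : R -> R[i].

Definition defect : L2 -> L2 :=
  sqrt_operator H2 (fun f => f - toeplitz b (toeplitz (fun t => (b t)^*) f)).

Definition dBR : set L2 := defect @` H2.

Definition dBR_lift g : L2 :=
  xget 0 [set f | orth_compl H2 [set h | H2 h /\ defect h = 0] f /\
                  defect f = g].

(* The inner product which makes [defect] a unitary map from the orthogonal
   complement of its kernel onto [dBR], i.e. the one of the range norm. *)
Definition dBR_inner f g : R[i] := inner (dBR_lift f) (dBR_lift g).

(* Two linear subspaces satisfying this are automatically closed in [dBR],
   each being the orthogonal complement of the other. *)
Definition dBR_orth_sum E1 E2 : Prop :=
  [/\ E1 `<=` dBR, E2 `<=` dBR,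
      dBR = [set f + g | f in E1 & g in E2] &
      forall f g, E1 f -> E2 g -> dBR_inner f g = 0].
End deBrangesRovnyak.
End Hilbert.
Arguments H2 R : clear implicits.

(* Main.v *)
Require Import Defs.
From HB Require Import structures.
From mathcomp Require Import all_boot all_order all_algebra.
From mathcomp Require Import generic_quotient ring_quotient.
From mathcomp Require Import all_classical all_reals all_analysis.
From mathcomp Require Import complex.
From mathcomp Require Import measurable_realfun ring lra.

(* Let V be multiplication by I on H^2, an isometry, and let primes denote
   adjoints. Put B = V^n (1 + V) / 2 and a = (1 - V) / 2, so that
   B'B + a'a = 1 and H(b) is the range of A = (1 - BB')^(1/2).
   By the Riesz representation theorem on the range of A, f lies in H(b) iff
   B'f + a'g = 0 for some g in H^2, and if moreover g is orthogonal to ker a',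
   then <f0, f>_b = <f0, f> + <g0, g> for every such pair (f0, g0).
   Writing p for the polynomial of the theorem, the pairs
   ((1 - V)h, V'^n(1 + V)h) and (pk, -k), with V'k = 0, are of this kind, and
   <(1 - V)h, pk> = <V'^n(1 + V)h, k> because (1 - V')pk = (1 + V')V^n k.
   Conversely, a pair (f, g) satisfies V'^n f = (1 - V)h + k with
   h = (V'^n f + g) / 2 and V'k = 0; then f is in (1 - V)H^2 + ker V' since
   f = V'f - (1 - V)V'f + (f - VV'f), and finally
   pk = (2n + 1)k modulo (1 - V)H^2.
   That I H^2 is contained in H^2 rests on the totality of the Fourier modes, and
   the square root is 1 - X, where X = (BB' + X^2) / 2 is the limit of the
   iteration started at 0. *)

Set Implicit Arguments.
Unset Strict Implicit.
Unset Printing Implicit Defensive.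

Import Order.TTheory GRing.Theory Num.Theory.
Import numFieldNormedType.Exports.

Local Open Scope classical_set_scope.
Local Open Scope ring_scope.
Local Open Scope complex_scope.

(** * Real parts of inner products and the Riesz theorem *)

(** The range of A becomes accessible because |A x|^2 = |A A x|^2 + |a B' x|^2: the map A x |-> (A A
    x, - a B' x) is isometric. Extended to the closure of the range, it attaches to f = A x, with x
    orthogonal to ker A, a partner g such that |x|^2 = |f|^2 + |g|^2, so that the norm of H(b) is
    computed from f and g without knowing x. This rests on the symmetry of A and on A A = 1 - BB',
    whichever root A has been chosen. The first kind of pair comes from (1 + V')(1 - V) + (1 - V')(1
    + V) = 2(1 - V'V) = 0. The coefficients of p are those for which (1 - V')pk telescopes, and 2n +
    1 = p(1). Real parts of inner products keep all estimates in R; complex orthogonality is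
    recovered by also testing against i times a vector. Totality enters since H^2 is defined by
    Fourier coefficients: <I f, e_k> = <f, conj(I) e_k> for k < 0, where conj(I) e_k is merely a
    limit of combinations of modes of negative frequency. *)

Section RealInnerProduct.
Context (R : realType) (E : lmodType R[i]) (r : E -> E -> R).

Local Notation q x := (r x x).
Local Notation N x := (Num.sqrt (r x x)).

(** Convergence and the Cauchy property are expressed by real sequences of squared norms, so that
    limits are only taken in R. *)
Definition converges (u : nat -> E) (l : E) :=
  (fun n => q (u n - l)) @ \oo --> (0 : R).

Definition cauchy_seq (u : nat -> E) := forall e : R, 0 < e ->
  exists M, forall m n, (M <= m)%N -> (M <= n)%N -> q (u m - u n) < e.

(* A complex Hilbert space is described by the real part [r] of its inner
   product, from which <x, y> = r x y + i r x (i y). *)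
Record hilbert : Prop := Hilbert {
  hilbertDl : forall x y z, r (x + y) z = r x z + r y z;
  hilbertZl : forall (a : R) x y, r (a%:C *: x) y = a * r x y;
  hilbertJ : forall x y, r ('i *: x) ('i *: y) = r x y;
  hilbertC : forall x y, r x y = r y x;
  hilbert_ge0 : forall x, 0 <= q x;
  hilbert_eq0 : forall x, q x = 0 -> x = 0;
  hilbert_complete : forall u, cauchy_seq u -> exists l, converges u l }.

Hypothesis hE : hilbert.

Lemma ripDl x y z : r (x + y) z = r x z + r y z. Proof. exact: hilbertDl. Qed.
Lemma ripDr x y z : r z (x + y) = r z x + r z y.
Proof. by rewrite !(hilbertC hE z) ripDl. Qed.
Lemma ripZl (a : R) x y : r (a%:C *: x) y = a * r x y.
Proof. exact: hilbertZl. Qed.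
Lemma ripZr (a : R) x y : r y (a%:C *: x) = a * r y x.
Proof. by rewrite !(hilbertC hE y) ripZl. Qed.
Lemma ripNl x y : r (- x) y = - r x y.
Proof. by rewrite -scaleN1r -(rmorphN1 (real_complex R)) ripZl mulN1r. Qed.
Lemma ripNr x y : r y (- x) = - r y x.
Proof. by rewrite !(hilbertC hE y) ripNl. Qed.
Lemma ripBl x y z : r (x - y) z = r x z - r y z.
Proof. by rewrite ripDl ripNl. Qed.
Lemma ripBr x y z : r z (x - y) = r z x - r z y.
Proof. by rewrite ripDr ripNr. Qed.
Lemma rip0l x : r 0 x = 0. Proof. by rewrite -(subrr x) ripBl subrr. Qed.
Lemma rip0r x : r x 0 = 0. Proof. by rewrite -(subrr x) ripBr subrr. Qed.
Lemma rip_sqr0 : q 0 = 0. Proof. exact: rip0l. Qed.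
Lemma rip_sqrN x : q (- x) = q x. Proof. by rewrite ripNl ripNr opprK. Qed.
Lemma rip_sqrBC x y : q (x - y) = q (y - x).
Proof. by rewrite -opprB rip_sqrN. Qed.
Lemma rip_sqrZ (a : R) x : q (a%:C *: x) = a ^+ 2 * q x.
Proof. by rewrite ripZl ripZr expr2 mulrA. Qed.
Lemma rip_sqrD x y : q (x + y) = q x + 2 * r x y + q y.
Proof. by rewrite ripDl !ripDr (hilbertC hE y x); ring. Qed.
Lemma rip_sqrB x y : q (x - y) = q x - 2 * r x y + q y.
Proof. by rewrite rip_sqrD rip_sqrN ripNr mulrN. Qed.
Lemma rip_inj x y : (forall z, r x z = r y z) -> x = y.
Proof.
move=> xy; apply/eqP; rewrite -subr_eq0; apply/eqP/(hilbert_eq0 hE).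
by rewrite ripBl xy subrr.
Qed.

Lemma rnorm_ge0 x : 0 <= N x. Proof. exact: sqrtr_ge0. Qed.
Lemma sqr_rnorm x : N x ^+ 2 = q x.
Proof. by rewrite sqr_sqrtr// (hilbert_ge0 hE). Qed.
Lemma rnormZ (a : R) x : N (a%:C *: x) = `|a| * N x.
Proof. by rewrite rip_sqrZ sqrtrM ?sqr_ge0// sqrtr_sqr. Qed.

Lemma rip_cauchy_schwarz x y : r x y <= N x * N y.
Proof.
have [qy0|qy0] := eqVneq (q y) 0.
  by rewrite (hilbert_eq0 hE qy0) !rip0r sqrtr0 mulr0.
have qy_gt0 : 0 < q y by rewrite lt_def qy0 (hilbert_ge0 hE).
have := hilbert_ge0 hE (x - (r x y / q y)%:C *: y).
rewrite rip_sqrB ripZr rip_sqrZ => h.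
have {}h : (r x y) ^+ 2 <= q x * q y.
  rewrite -subr_ge0.
  suff -> : q x * q y - (r x y) ^+ 2 = (q x - 2 * (r x y / q y * r x y) +
      (r x y / q y) ^+ 2 * q y) * q y by rewrite mulr_ge0// ltW.
  by field.
rewrite -sqrtrM ?(hilbert_ge0 hE)//.
have [xy0|xy0] := leP (r x y) 0; first exact: le_trans xy0 (sqrtr_ge0 _).
by rewrite -[leLHS](ger0_norm (ltW xy0)) -sqrtr_sqr ler_wsqrtr.
Qed.

Lemma rip_cauchy_schwarz_norm x y : `|r x y| <= N x * N y.
Proof.
rewrite ler_norml rip_cauchy_schwarz andbT -[r x y]opprK -ripNl lerN2.
by rewrite (le_trans (rip_cauchy_schwarz _ _))// rip_sqrN.
Qed.

Lemma ler_rnormD x y : N (x + y) <= N x + N y.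
Proof.
rewrite -(@ler_pXn2r _ 2)// ?nnegrE ?addr_ge0 ?rnorm_ge0//.
rewrite sqr_rnorm rip_sqrD sqrrD !sqr_rnorm mulr2n.
by have := rip_cauchy_schwarz x y; lra.
Qed.

Lemma rnormN x : N (- x) = N x. Proof. by rewrite rip_sqrN. Qed.

Lemma convergesP u l : converges u l <-> (fun n => N (u n - l)) @ \oo --> (0 : R).
Proof.
split=> ul.
  rewrite -[X in _ --> X](@sqrtr0 R).
  by apply: (cvg_comp _ Num.sqrt ul); exact: sqrt_continuous.
rewrite /converges (_ : (fun n => _) = (fun n => N (u n - l)) \* (fun n => N (u n - l))).
  by rewrite -[X in _ --> X](mulr0 (0 : R)); exact: cvgM.
by apply/funext => n /=; rewrite -expr2 sqr_rnorm.
Qed.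

Lemma converges_cst x : converges (fun=> x) x.
Proof. by apply: cvg_near_cst; apply: nearW => n; rewrite subrr rip_sqr0. Qed.

Lemma converges_lip (c : R) u l v m :
  (forall n, N (v n - m) <= c * N (u n - l)) -> converges u l -> converges v m.
Proof.
move=> h /convergesP ul; apply/convergesP.
apply: (@squeeze_cvgr _ _ _ _ (fun=> 0) (fun n => c * N (u n - l))).
- by apply: nearW => n; rewrite rnorm_ge0 h.
- exact: cvg_cst.
- by rewrite -[X in _ --> X](mulr0 c); apply: cvgM => //; exact: cvg_cst.
Qed.

Lemma convergesD u v l m : converges u l -> converges v m ->
  converges (fun n => u n + v n) (l + m).
Proof.
move=> /convergesP ul /convergesP vm; apply/convergesP.
apply: (@squeeze_cvgr _ _ _ _ (fun=> 0) (fun n => N (u n - l) + N (v n - m))).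
- by apply: nearW => n; rewrite rnorm_ge0 opprD addrACA ler_rnormD.
- exact: cvg_cst.
- by rewrite -[X in _ --> X](addr0 (0 : R)); exact: cvgD.
Qed.

Lemma converges_rip u l y : converges u l -> (fun n => r (u n) y) @ \oo --> r l y.
Proof.
move=> /convergesP ul.
have h : (fun n => r (u n - l) y) @ \oo --> (0 : R).
  apply/norm_cvg0P; apply: (@squeeze_cvgr _ _ _ _ (fun=> 0) (fun n => N (u n - l) * N y)).
  - by apply: nearW => n; rewrite normr_ge0 rip_cauchy_schwarz_norm.
  - exact: cvg_cst.
  - by rewrite -[X in _ --> X](mul0r (N y)); apply: cvgM => //; exact: cvg_cst.
rewrite -[X in _ --> X]add0r (_ : (fun n => _) = (fun n => r (u n - l) y) \+ cst (r l y)).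
  by apply: cvgD => //; exact: cvg_cst.
by apply/funext => n /=; rewrite ripBl subrK.
Qed.

Lemma converges_norm u l : converges u l -> (fun n => N (u n)) @ \oo --> N l.
Proof.
move=> /convergesP ul.
apply/subr_cvg0/norm_cvg0P.
apply: (@squeeze_cvgr _ _ _ _ (fun=> 0) (fun n => N (u n - l))) => //.
- apply: nearW => n; rewrite normr_ge0 /= ler_norml.
  have := ler_rnormD (u n - l) l; rewrite subrK => h1.
  have := ler_rnormD (u n) (- (u n - l)); rewrite rnormN opprB addrC subrK => h2.
  by lra.
- exact: cvg_cst.
Qed.

Lemma converges_unique u l m : converges u l -> converges u m -> l = m.
Proof.
move=> ul um; apply: rip_inj => z.
by apply: (@cvg_unique _ _ ((fun n => r (u n) z) @ \oo)) => //; exact: converges_rip.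
Qed.

Lemma converges_cauchy u l : converges u l -> cauchy_seq u.
Proof.
move=> /convergesP ul e e0.
have s0 : 0 < Num.sqrt e / 2 by rewrite divr_gt0 ?sqrtr_gt0.
have [M _ hM] := (cvgrPdist_lt _ _).1 ul _ s0.
exists M => m n Mm Mn.
have h k : (M <= k)%N -> N (u k - l) < Num.sqrt e / 2.
  by move=> /hM /=; rewrite sub0r normrN ger0_norm ?rnorm_ge0.
rewrite -sqr_rnorm -(@sqr_sqrtr _ e) ?ltW// ltr_pXn2r ?nnegrE ?rnorm_ge0//.
rewrite -(subrKA l) (le_lt_trans (ler_rnormD _ _))// -[l - u n]opprB rnormN.
by have := h _ Mm; have := h _ Mn; lra.
Qed.

(* The Riesz representation theorem on the closure of the range of [A], for a
   functional given on the range by [A h |-> l h]. *)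
Lemma riesz (F : lmodType R[i]) (D : set F) (A : {linear F -> E}) (l : F -> R)
    (c : R) :
  D 0 -> (forall (a : R[i]) x y, D x -> D y -> D (a *: x + y)) ->
  (forall (a : R) x y, l (a%:C *: x + y) = a * l x + l y) ->
  (forall h, D h -> l h <= c * N (A h)) ->
  exists f u, [/\ (forall n, D (u n)), converges (A \o u) f &
    forall h, D h -> r (A h) f = l h].
Proof.
move=> D0 DD lD lc.
(* The vector sought is the limit of [A h] along a minimizing sequence of this quadratic
   functional. *)
pose J h := q (A h) / 2 - l h.
pose S := [set J h | h in D].
have Jlb h : D h -> - c ^+ 2 / 2 <= J h.
  move=> /lc lch; rewrite /J -sqr_rnorm.
  have := sqr_ge0 (N (A h) - c); rewrite sqrrB mulr2n; lra.
have S_inf : has_inf S.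
  split; first by exists (J 0); exists 0.
  by exists (- c ^+ 2 / 2) => _ [h Dh <-]; exact: Jlb.
set I0 := inf S.
have I0_le h : D h -> I0 <= J h.
  by move=> Dh; apply: ge_inf; [exact: S_inf.2|exists h].
have /choice[u hu] : forall n : nat, exists h, D h /\ J h < I0 + n.+1%:R^-1.
  move=> n; have n0 : 0 < n.+1%:R^-1 :> R by rewrite invr_gt0.
  by have [_ [h Dh <-]] := inf_adherent n0 S_inf; exists h.
have Du n : D (u n) by case: (hu n).
have DN x y : D x -> D y -> D (x - y).
  by move=> Dx Dy; rewrite -[- y]scaleN1r addrC; exact: DD.
have JD (e : R) x y : J (e%:C *: x + y) =
    J y + e * (r (A x) (A y) - l x) + e ^+ 2 * (q (A x) / 2).
  by rewrite /J lD linearP rip_sqrD rip_sqrZ ripZl; field.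
have AuC : cauchy_seq (A \o u).
  move=> e e0.
  (* Parallelogram argument: at the midpoint of [u m] and [u n], J is the mean of its two values
     minus q(A (u m) - A (u n)) / 8, and it is still at least the infimum; hence the tolerance e /
     8. *)
  have [M _ hM] := near_infty_natSinv_lt (PosNum (divr_gt0 e0 (ltr0n R 8))).
  exists M => m n Mm Mn /=.
  have /= Jm := hM _ Mm; have /= Jn := hM _ Mn.
  have := I0_le ((2^-1 : R)%:C *: (u m - u n) + u n) (DD _ _ _ (DN _ _ (Du m) (Du n)) (Du n)).
  have := JD 1 (u m - u n) (u n); rewrite scale1r subrK JD -linearB.
  set P := (_ - l _); set Q := q _ => Jmn.
  have [_] := hu m; have [_] := hu n.
  rewrite Jmn; clear -Jm Jn; move: Jm Jn.
  by move: (J _) (m.+1%:R^-1) (n.+1%:R^-1) => ? ? ?; lra.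
have [f Auf] := hilbert_complete hE AuC.
exists f, u; split=> // h Dh.
have lim1 := converges_rip (y := A h) Auf.
(* The variation of J in the direction h, taken at [u n] and passed to the limit. A quadratic
   polynomial in e that is nonnegative and vanishes at 0 has no linear term. *)
have key (e : R) : 0 <= e ^+ 2 * (q (A h) / 2) + e * (r (A h) f - l h).
  have lim : (fun n => e ^+ 2 * (q (A h) / 2) + n.+1%:R^-1 +
      e * (r (A (u n)) (A h) - l h)) @ \oo -->
      e ^+ 2 * (q (A h) / 2) + 0 + e * (r f (A h) - l h).
    apply: cvgD; first by apply: cvgD; [exact: cvg_cst|exact: cvg_harmonic].
    apply: cvgM; first exact: cvg_cst.
    by apply: cvgB; [exact: lim1|exact: cvg_cst].
  rewrite addr0 in lim; rewrite [r (A h) f](hilbertC hE).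
  rewrite -(cvg_lim (@Rhausdorff R) lim); apply: limr_ge.
    by apply/cvg_ex; eexists; exact: lim.
  apply: nearW => n.
  have := I0_le _ (DD e%:C _ _ Dh (Du n)); have [_] := hu n.
  rewrite JD [r (A h) (A (u n))](hilbertC hE).
  by move: (J _) (n.+1%:R^-1) => ? ?; lra.
apply/eqP; rewrite -subr_eq0; apply/eqP; set z := _ - _.
set Q := q (A h) in key.
have Q0 : 0 <= Q by exact: hilbert_ge0.
(* The minimizer would be - z / Q; adding 1 covers the case Q = 0. *)
have := key (- z / (Q + 1)).
have -> : (- z / (Q + 1)) ^+ 2 * (Q / 2) + (- z / (Q + 1)) * z =
    - (z ^+ 2) * ((Q / 2 + 1) / (Q + 1) ^+ 2).
  by field; lra.
rewrite mulNr oppr_ge0 pmulr_lle0; last by rewrite divr_gt0 ?exprn_gt0//; lra.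
by move=> z2; apply/eqP; rewrite -sqrf_eq0 eq_le z2 sqr_ge0.
Qed.
End RealInnerProduct.

(** * Positive square roots *)

Section Operators.
Context (R : realType) (E : lmodType R[i]) (r : E -> E -> R) (hE : hilbert r).
Local Notation q x := (r x x).
Local Notation N x := (Num.sqrt (r x x)).

Definition linear_pack (f : E -> E) (f_lin : linear f) : {linear E -> E} :=
  HB.pack f (GRing.isLinear.Build R[i] E E *:%R f f_lin).

Lemma ripiC x y : r ('i *: x) y = - r x ('i *: y).
Proof.
by rewrite -(hilbertJ hE) scalerA -expr2 sqr_i scaleN1r (ripNl hE).
Qed.

Lemma rnorm_scale (a : R[i]) x :
  N (a *: x) <= (`|complex.Re a| + `|complex.Im a|) * N x.
Proof.
have -> : a *: x = (complex.Re a)%:C *: x + (complex.Im a)%:C *: ('i *: x).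
  by rewrite scalerA -scalerDl mulrC -complexE.
rewrite (le_trans (ler_rnormD hE _ _))// mulrDl !rnormZ//.
by rewrite (hilbertJ hE).
Qed.

Lemma convergesZ (a : R[i]) u l : converges r u l -> converges r (fun n => a *: u n) (a *: l).
Proof.
apply: (@converges_lip _ _ _ hE (`|complex.Re a| + `|complex.Im a|)) => n.
by rewrite -scalerBr rnorm_scale.
Qed.

Lemma converges_linear (A : {linear E -> E}) (c : R) u l :
  (forall x, N (A x) <= c * N x) -> converges r u l ->
  converges r (fun n => A (u n)) (A l).
Proof. by move=> Ac; apply: (@converges_lip _ _ _ hE c) => n; rewrite -linearB. Qed.

Lemma converges_shift u l : converges r u l -> converges r (fun n => u n.+1) l.
Proof.
move=> ul; rewrite /converges.
by rewrite (cvg_shiftS (fun n => q (u n - l))).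
Qed.

Section SquareRoot.
Context (C : {linear E -> E}).
Hypothesis C_sym : forall x y, r (C x) y = r x (C y).
Hypothesis C_contr : forall x, N (C x) <= N x.

Fixpoint sqrt_iter (n : nat) : E -> E :=
  if n is n'.+1 then
    fun x => (2^-1 : R)%:C *: (C x + sqrt_iter n' (sqrt_iter n' x))
  else fun=> 0.

(** The same iteration for the scalar C = 1. It dominates the norms of the operators and of their
    increments, so its monotone convergence makes the operator iteration Cauchy. *)
Fixpoint sqrt_iter_bound (n : nat) : R :=
  if n is n'.+1 then (1 + sqrt_iter_bound n' ^+ 2) / 2 else 0.
Local Notation S := sqrt_iter.
Local Notation s := sqrt_iter_bound.

Lemma sqrt_iterS n x : S n.+1 x = (2^-1 : R)%:C *: (C x + S n (S n x)).
Proof. by []. Qed.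

Lemma sqrt_iter_linear n : linear (S n).
Proof.
elim: n => [|n IH] a x y /=; first by rewrite scaler0 addr0.
by rewrite linearP 2!IH addrACA -scalerDr [LHS]scalerDr !scalerA [a * _]mulrC.
Qed.

(** Each stage is a polynomial in C. The commutation of the stages with each other, which follows,
    is what allows differences of squares to be factored. *)
Lemma sqrt_iter_comm n (Y : E -> E) : linear Y ->
  (forall x, Y (C x) = C (Y x)) -> forall x, Y (S n x) = S n (Y x).
Proof.
move=> Ylin YC; pose Y' := linear_pack Ylin.
elim: n => [|n IH] x /=; first exact: (linear0 Y').
have YZ : forall a y, Y (a *: y) = a *: Y y := linearZZ Y'.
have YD : forall y z, Y (y + z) = Y y + Y z := linearD Y'.
by rewrite YZ YD YC !IH.
Qed.

Lemma sqrt_iterC m n x : S m (S n x) = S n (S m x).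
Proof.
apply: sqrt_iter_comm; first exact: sqrt_iter_linear.
by move=> y; apply/esym/sqrt_iter_comm => //; exact: linearP.
Qed.

Lemma sqrt_iter_sym n x y : r (S n x) y = r x (S n y).
Proof.
elim: n x y => [|n IH] x y /=; first by rewrite (rip0l hE) (rip0r hE).
by rewrite (ripZl hE) (ripZr hE) (ripDl hE) (ripDr hE) C_sym !IH.
Qed.

Lemma sqrt_iter_bound01 n : 0 <= s n <= 1.
Proof. by elim: n => [|n /andP[s0 s1]] /=; [rewrite lexx ler01|nra]. Qed.

Lemma sqrt_iter_bound_nd n : s n <= s n.+1.
Proof. by have /andP[s0 s1] := sqrt_iter_bound01 n; rewrite /=; nra. Qed.

Lemma sqrt_iter_le n x : N (S n x) <= s n * N x.
Proof.
elim: n x => [|n IH] x /=; first by rewrite (rip0l hE) sqrtr0 mul0r.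
have /andP[s0 s1] := sqrt_iter_bound01 n.
rewrite rnormZ// ger0_norm// mulrAC mulrC ler_pM2r//.
rewrite (le_trans (ler_rnormD hE _ _))// mulrDl mul1r lerD//.
by rewrite (le_trans (IH _))// expr2 -mulrA ler_wpM2l.
Qed.

(** As the stages commute, each increment is half the sum of the two previous stages applied to the
    previous increment. The scalars obey the same recursion with equality. *)
Lemma sqrt_iter_step n x : N (S n.+1 x - S n x) <= (s n.+1 - s n) * N x.
Proof.
elim: n x => [|n IH] x.
  rewrite !subr0 /= addr0 rnormZ// ger0_norm// expr0n addr0 mul1r.
  by rewrite ler_pM2l.
have SB m y z : S m (y - z) = S m y - S m z := linearB (linear_pack (sqrt_iter_linear m)) y z.
rewrite (_ : S n.+2 x - S n.+1 x = (2^-1 : R)%:C *: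
    (S n.+1 (S n.+1 x - S n x) + S n (S n.+1 x - S n x))); last first.
  rewrite sqrt_iterS; set y := S n.+1 x.
  rewrite [X in _ - X = _](_ : y = (2^-1 : R)%:C *: (C x + S n (S n x)))//.
  rewrite -scalerBr !SB [S n.+1 (S n x)]sqrt_iterC -/y subrKA; congr (_ *: _).
  by rewrite opprD addrACA subrr add0r.
rewrite rnormZ// ger0_norm//.
have := ler_rnormD hE (S n.+1 (S n.+1 x - S n x)) (S n (S n.+1 x - S n x)).
have := sqrt_iter_le n.+1 (S n.+1 x - S n x).
have := sqrt_iter_le n (S n.+1 x - S n x).
have := IH x; move: (S n.+1 x - S n x) => y.
have /andP[] := sqrt_iter_bound01 n; have /andP[] := sqrt_iter_bound01 n.+1.
have -> : s n.+2 - s n.+1 = (s n.+1 + s n) * (s n.+1 - s n) / 2 by rewrite /=; field.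
move: (s n.+1) (s n) (N x) (N y) (N (S n y)) (N (S n.+1 y)) => a b X Y Z1 Z2.
move=> a0 a1 b0 b1 YX z1 z2 z.
have : (a + b) * Y <= (a + b) * ((a - b) * X) by rewrite ler_wpM2l ?addr_ge0.
by lra.
Qed.

Lemma sqrt_iter_dist m n x : (n <= m)%N -> N (S m x - S n x) <= (s m - s n) * N x.
Proof.
elim: m => [|m IH]; first by rewrite leqn0 => /eqP ->; rewrite !subrr mul0r rip_sqr0// sqrtr0.
rewrite leq_eqVlt => /predU1P[->|]; first by rewrite !subrr mul0r rip_sqr0// sqrtr0.
rewrite ltnS => /IH {}IH.
rewrite -(subrKA (S m x)) (le_trans (ler_rnormD hE _ _))//.
by rewrite -(subrKA (s m) (s m.+1)) mulrDl lerD// sqrt_iter_step.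
Qed.

Lemma sqrt_iter_cauchy x : cauchy_seq r (fun n => S n x).
Proof.
have nd : nondecreasing_seq s by apply/nondecreasing_seqP; exact: sqrt_iter_bound_nd.
have cs : cvgn s.
  apply: nondecreasing_is_cvgn => //.
  by exists 1 => _ [n _ <-]; case/andP: (sqrt_iter_bound01 n).
move=> e e0.
have d0 : 0 < Num.sqrt e / (N x + 1) by rewrite divr_gt0 ?sqrtr_gt0// ltr_wpDl ?sqrtr_ge0.
have [M _ hM] := (cvgrPdist_lt _ _).1 cs _ d0.
have hM' k : (M <= k)%N -> limn s - s k < Num.sqrt e / (N x + 1).
  by move=> /hM; exact/le_lt_trans/ler_norm.
have H m n : (M <= n)%N -> (n <= m)%N -> q (S m x - S n x) < e.
  move=> Mn nm; rewrite -(sqr_rnorm hE) -(@sqr_sqrtr _ e) ?ltW// ltr_pXn2r ?nnegrE ?sqrtr_ge0//.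
  rewrite (le_lt_trans (sqrt_iter_dist _ nm))//.
  have h1 := hM' _ Mn; have h2 := nondecreasing_cvgn_le nd cs m.
  have x0 : 0 < N x + 1 by rewrite ltr_wpDl ?sqrtr_ge0.
  rewrite ltr_pdivlMr// in h1.
  have := nd _ _ nm; have := sqrtr_ge0 (q x) => h3 h4.
  by nra.
exists M => m n Mm Mn; have [nm|/ltnW nm] := leqP n m; first exact: H.
by rewrite rip_sqrBC//; exact: H.
Qed.

(** For A = 1 - X, positivity and the bound 2 both come from |X x| <= |x|, which passes to the limit
    from the stages. *)
Lemma sqrt_operator_ex : exists A : {linear E -> E},
  [/\ forall x y, r (A x) y = r x (A y), forall x, 0 <= r (A x) x,
      forall x, N (A x) <= 2 * N x & forall x, A (A x) = x - C x].
Proof.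
have /choice[X hX] : forall x, exists l, converges r (fun n => S n x) l.
  by move=> x; apply: hilbert_complete => //; exact: sqrt_iter_cauchy.
have Xlin : linear X.
  move=> a x y; apply: (@converges_unique _ _ _ hE _ _ _ (hX _)).
  rewrite (_ : (fun n => _) = (fun n => a *: S n x + S n y)); last first.
    by apply/funext => n; exact: sqrt_iter_linear.
  by apply: convergesD => //; exact: convergesZ.
have XN x : N (X x) <= N x.
  have h := @converges_norm _ _ _ hE _ _ (hX x).
  rewrite -(cvg_lim (@Rhausdorff R) h); apply: limr_le.
    by apply/cvg_ex; eexists; exact: h.
  apply: nearW => n; rewrite (le_trans (sqrt_iter_le _ _))//.
  by rewrite ler_piMl ?sqrtr_ge0//; case/andP: (sqrt_iter_bound01 n).
have Xsym x y : r (X x) y = r x (X y).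
  have h1 := @converges_rip _ _ _ hE _ _ y (hX x).
  have h2 := @converges_rip _ _ _ hE _ _ x (hX y).
  rewrite [r x _](hilbertC hE); apply: (cvg_unique _ h1) => //.
  rewrite (_ : (fun n => _) = (fun n => r (S n y) x))//.
  by apply/funext => n; rewrite sqrt_iter_sym (hilbertC hE x).
(* Strong convergence passes to squares because the stages are uniformly contractive: split S n x
   into (S n x - X x) + X x. *)
have SSX x : converges r (fun n => S n (S n x)) (X (X x)).
  rewrite (_ : (fun n => _) = (fun n => S n (S n x - X x) + S n (X x))); last first.
    apply/funext => n.
    by have /= -> := linearB (linear_pack (sqrt_iter_linear n)) (S n x) (X x); rewrite subrK.
  rewrite -[X in converges r _ X]add0r; apply: convergesD => //.
  apply: (@converges_lip _ _ _ hE 1 (fun n => S n x) (X x)) => // n.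
  rewrite subr0 (le_trans (sqrt_iter_le _ _))// ler_wpM2r ?sqrtr_ge0//.
  by case/andP: (sqrt_iter_bound01 n).
have XE x : (2 : R)%:C *: X x = C x + X (X x).
  have h1 := convergesZ (2 : R)%:C (converges_shift (hX x)).
  apply: (converges_unique hE h1).
  rewrite (_ : (fun n => _) = (fun n => C x + S n (S n x))); last first.
    by apply/funext => n; rewrite sqrt_iterS scalerA -rmorphM divff// scale1r.
  by apply: convergesD => //; exact: converges_cst.
have Alin : linear (fun x => x - X x).
  by move=> a x y; rewrite Xlin scalerBr opprD addrACA.
pose X' := linear_pack Xlin.
exists (linear_pack Alin); split=> [x y|x|x|x] /=.
- by rewrite (ripBl hE) (ripBr hE) Xsym.
- rewrite (ripBl hE) subr_ge0 (le_trans (rip_cauchy_schwarz hE _ _))//.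
  by rewrite -[leRHS](sqr_rnorm hE) expr2 ler_wpM2r ?sqrtr_ge0.
- rewrite (le_trans (ler_rnormD hE _ _))// rnormN//.
  by have := XN x; lra.
- have XB : forall y z, X (y - z) = X y - X z := linearB X'.
  have XX : X x + X x = C x + X (X x).
    by rewrite -XE (rmorph_nat (real_complex R)) scaler_nat mulr2n.
  by rewrite XB opprB addrACA -opprD XX opprD addrACA subrr addr0.
Qed.
End SquareRoot.
End Operators.

(** * Ranges of complementary operators *)

Section ComplementaryRange.
Context (R : realType) (E : lmodType R[i]) (r : E -> E -> R) (hE : hilbert r).
Local Notation q x := (r x x).
Local Notation N x := (Num.sqrt (r x x)).
Local Notation converges := (converges r).

Context (A B B' a a' : {linear E -> E}).
Hypothesis A_sym : forall x y, r (A x) y = r x (A y).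
Hypothesis B_adj : forall x y, r (B x) y = r x (B' y).
Hypothesis a_adj : forall x y, r (a x) y = r x (a' y).
Hypothesis Ba_isometry : forall x, B' (B x) + a' (a x) = x.
Hypothesis AA : forall x, A (A x) = x - B (B' x).

(** The kernel is a complex subspace, so real orthogonality to it amounts to complex
    orthogonality. *)
Definition orth_ker (x : E) := forall y, A y = 0 -> r x y = 0.

Lemma sqrt_defect_rip x y : r (A x) (A y) = r x y - r (B' x) (B' y).
Proof. by rewrite -A_sym AA (ripBl hE) B_adj. Qed.

(** By [Ba_isometry], |B B' x|^2 falls short of |B' x|^2 by exactly |a B' x|^2; the rest is the
    expansion of |x - B B' x|^2. *)
Lemma sqrt_defect_sqr x : q (A x) = q (A (A x)) + q (a (B' x)).
Proof.
rewrite a_adj (_ : a' (a (B' x)) = B' x - B' (B (B' x))); last first.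
  by rewrite -[X in _ = X - _](Ba_isometry (B' x)) addrC addKr.
rewrite AA sqrt_defect_rip !(ripBl hE) !(ripBr hE) [r x (B _)](hilbertC hE) !B_adj.
by lra.
Qed.

Lemma sqrt_defect_le x : N (A x) <= N x.
Proof. by rewrite ler_wsqrtr// sqrt_defect_rip gerBl (hilbert_ge0 hE). Qed.

Lemma complement_le x : N (a (B' x)) <= N (A x).
Proof. by rewrite ler_wsqrtr// sqrt_defect_sqr lerDr (hilbert_ge0 hE). Qed.

(** Half of the identification of the closure of the range of A with the orthogonal complement of
    its kernel; [orth_ker_lift] is the other half. *)
Lemma converges_range_orth u x : converges (A \o u) x -> orth_ker x.
Proof.
move=> Aux y Ay0; apply: (cvg_unique _ (converges_rip hE (y := y) Aux)) => //.
by apply: cvg_near_cst; apply: nearW => n /=; rewrite A_sym Ay0 (rip0r hE).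
Qed.

(** A preimage of f represents the functional A h |-> <f, h>. It is bounded: writing h = A A h + B
    B' h and using the pair equation, <f, h> = <f, A A h> - <g, a B' h>, and both A A h and a B' h
    are dominated by A h. *)
Lemma range_of_pair f g : B' f + a' g = 0 ->
  exists x u, converges (A \o u) x /\ A x = f.
Proof.
move=> fg0.
have [||h _|x [u [_ Aux Axf]]] := @riesz _ _ _ hE E setT A (r f) (N f + N g) I _.
- by [].
- by move=> c x y; rewrite (ripDr hE) (ripZr hE).
- have -> : r f h = r f (A (A h)) - r g (a (B' h)).
    rewrite AA (ripBr hE) [r f (B _)](hilbertC hE) B_adj [r g _](hilbertC hE) a_adj.
    by rewrite -addrA -opprD -(ripDr hE) fg0 (rip0r hE) subr0.
  have := rip_cauchy_schwarz_norm hE f (A (A h)).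
  have := rip_cauchy_schwarz_norm hE g (a (B' h)).
  rewrite !ler_norml => /andP[h1 _] /andP[_ h2].
  have := ler_wpM2l (rnorm_ge0 r f) (sqrt_defect_le (A h)).
  have := ler_wpM2l (rnorm_ge0 r g) (complement_le h).
  by lra.
exists x, u; split => //; apply: (rip_inj hE) => z.
by rewrite A_sym (hilbertC hE) Axf.
Qed.

(** Here x' is the projection of x onto the closure of the range of A, obtained from the functional
    A h |-> <x, A h>. It is the preimage of A x of least norm. *)
Lemma closed_range_lift x : exists x' u, converges (A \o u) x' /\ A x' = A x.
Proof.
have [||h _|x' [u [_ Aux Ax]]] :=
  @riesz _ _ _ hE E setT A (fun h => r x (A h)) (N x) I _.
- by [].
- by move=> c y z; rewrite linearP (ripDr hE) (ripZr hE).
- exact: rip_cauchy_schwarz.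
exists x', u; split => //; apply: (rip_inj hE) => z.
by rewrite A_sym (hilbertC hE) Ax// A_sym.
Qed.

Lemma orth_ker_lift x : orth_ker x -> exists u, converges (A \o u) x.
Proof.
move=> xK; have [x' [u [Aux Ax]]] := closed_range_lift x.
exists u; suff -> : x = x' by [].
apply/eqP; rewrite -subr_eq0; apply/eqP/(hilbert_eq0 hE).
have Axx' : A (x - x') = 0 by rewrite linearB Ax subrr.
by rewrite (ripBl hE) xK// (converges_range_orth Aux)// subrr.
Qed.

(** The partner of A x is the limit of - a B' u_n, which is Cauchy by [sqrt_defect_sqr]. The pair
    equation holds along the sequence since B' A A = B' - B' B B' = a' a B', and a limit of values
    of a is orthogonal to ker a'. *)
Lemma complement_pair u x : converges (A \o u) x ->
  exists g, [/\ converges (fun n => - a (B' (u n))) g, B' (A x) + a' g = 0 &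
    forall z, a' z = 0 -> r g z = 0].
Proof.
move=> Aux.
have [g ug] : exists g, converges (fun n => - a (B' (u n))) g.
  apply: (hilbert_complete hE) => e e0.
  have [M hM] := converges_cauchy hE Aux e0.
  exists M => m n Mm Mn; rewrite -opprD (rip_sqrN hE) -!linearB /=.
  apply: le_lt_trans (hM m n Mm Mn); rewrite /= -linearB.
  by rewrite [leRHS]sqrt_defect_sqr lerDr (hilbert_ge0 hE).
exists g; split => //.
- have AAux : converges (fun n => A (A (u n))) (A x).
    apply: (@converges_linear _ _ _ hE A 1 (A \o u)) => // y.
    by rewrite mul1r sqrt_defect_le.
  apply: (rip_inj hE) => z; rewrite (rip0l hE) (ripDl hE).
  rewrite (hilbertC hE) -B_adj (hilbertC hE) [r (a' g) z](hilbertC hE) -a_adj.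
  rewrite [r (a z) g](hilbertC hE).
  have L := cvgD (converges_rip hE (y := B z) AAux) (converges_rip hE (y := a z) ug).
  apply: (cvg_unique _ (L _)) => //.
  apply: cvg_near_cst; apply: nearW => n /=.
  rewrite fctE (hilbertC hE) B_adj [X in _ + X](hilbertC hE) a_adj -(ripDr hE).
  rewrite AA linearB linearN -{1}(Ba_isometry (B' (u n))) /=.
  by rewrite [B' (B _) + _]addrC addrK subrr (rip0r hE).
- move=> z az0; apply: (cvg_unique _ (converges_rip hE (y := z) ug)) => //.
  apply: cvg_near_cst; apply: nearW => n /=.
  by rewrite (ripNl hE) a_adj az0 (rip0r hE) oppr0.
Qed.

Lemma pair_of_range x : exists g, B' (A x) + a' g = 0.
Proof.
have [x' [u [Aux' <-]]] := closed_range_lift x.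
by have [g [_ ? _]] := complement_pair Aux'; exists g.
Qed.

(** Polarized form of the isometry. With x2 the limit of A u_n, <x1, A u_n> = <A x1, u_n>; writing
    u_n = A A u_n + B B' u_n and using the first pair equation gives <A x1, A A u_n> - <g1, a B'
    u_n>. *)
Lemma range_inner x1 x2 g1 g2 : B' (A x1) + a' g1 = 0 -> B' (A x2) + a' g2 = 0 ->
  orth_ker x2 -> (forall z, a' z = 0 -> r g2 z = 0) ->
  r x1 x2 = r (A x1) (A x2) + r g1 g2.
Proof.
move=> p1 p2 /orth_ker_lift[u Aux2] g2K.
have [g [ug pg gK]] := complement_pair Aux2.
(* Two partners of the same vector differ by an element of ker a', to which both are orthogonal. *)
have -> : g2 = g.
  apply/eqP; rewrite -subr_eq0; apply/eqP/(hilbert_eq0 hE).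
  have agg : a' (g2 - g) = 0.
    by rewrite linearB; apply/eqP; rewrite subr_eq0 -(inj_eq (addrI (B' (A x2)))) p2 pg.
  by rewrite (ripBl hE) g2K// gK// subrr.
have AAux : converges (fun n => A (A (u n))) (A x2).
  apply: (@converges_linear _ _ _ hE A 1 (A \o u)) => // y.
  by rewrite mul1r sqrt_defect_le.
have L := cvgD (converges_rip hE (y := A x1) AAux) (converges_rip hE (y := g1) ug) _.
rewrite (hilbertC hE) [r (A x1) _](hilbertC hE) [r g1 g](hilbertC hE).
apply: (cvg_unique _ (converges_rip hE (y := x1) Aux2)) => //.
rewrite (_ : (fun n => r ((A \o u) n) x1) =
  (fun n => r (A (A (u n))) (A x1)) \+ (fun n => r (- a (B' (u n))) g1)).
  exact: L.
apply/funext => n /=; rewrite AA (ripBl hE) (ripNl hE) B_adj a_adj A_sym -addrA -opprD.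
by rewrite -(ripDr hE) p1 (rip0r hE) subr0.
Qed.
End ComplementaryRange.

(** * The operators attached to an isometry *)

Section IsometryDefect.
Context (R : realType) (E : lmodType R[i]) (r : E -> E -> R) (hE : hilbert r).
Local Notation N x := (Num.sqrt (r x x)).

Lemma rip_half x y : r (2^-1 *: x) y = r x y / 2.
Proof.
have -> : 2^-1 = (2^-1 : R)%:C by rewrite fmorphV/= rmorph_nat.
by rewrite (ripZl hE) mulrC.
Qed.

(* Identities in [E] which are linear over the rationals are tested against all
   vectors, where they become identities in [R]. *)
Ltac lmod_eq := apply: (rip_inj hE) => ?;
  rewrite ?((ripBl hE), (ripDl hE), (ripNl hE), rip_half, (rip0l hE)); lra.

Context (V W : {linear E -> E}) (n : nat).
Hypothesis V_adj : forall x y, r (V x) y = r x (W y).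
Hypothesis V_isometry : forall x, W (V x) = x.

Definition symbol_op (x : E) : E := 2^-1 *: iter n V (x + V x).
Definition symbol_adj (x : E) : E := 2^-1 *: (iter n W x + W (iter n W x)).

(** The polynomial p evaluated at V, in Horner form: p_0 = 1 and p_{m+1} = 2 + z p_m. *)
Fixpoint kernel_op (m : nat) (x : E) : E :=
  if m is m'.+1 then x + x + V (kernel_op m' x) else x.

Lemma iter_linear (f : {linear E -> E}) m : linear (iter m f).
Proof. by elim: m => [//|m IH] c x y; rewrite !iterS IH linearP. Qed.

Lemma iterD_linear (f : {linear E -> E}) m x y :
  iter m f (x + y) = iter m f x + iter m f y.
Proof. exact: (linearD (linear_pack (iter_linear f m))). Qed.

Lemma iterB_linear (f : {linear E -> E}) m x y :
  iter m f (x - y) = iter m f x - iter m f y.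
Proof. exact: (linearB (linear_pack (iter_linear f m))). Qed.

Lemma iterZ_linear (f : {linear E -> E}) m c x :
  iter m f (c *: x) = c *: iter m f x.
Proof. exact: (linearZZ (linear_pack (iter_linear f m))). Qed.

Lemma kernel_op_linear m : linear (kernel_op m).
Proof.
elim: m => [//|m IH] c x y /=; rewrite IH linearP !scalerDr; lmod_eq.
Qed.

Lemma symbol_op_linear : linear symbol_op.
Proof.
move=> c x y; rewrite /symbol_op linearP addrACA -scalerDr.
by rewrite iter_linear [LHS]scalerDr !scalerA [_ * c]mulrC.
Qed.

Lemma symbol_adj_linear : linear symbol_adj.
Proof.
move=> c x y; rewrite /symbol_adj iter_linear linearP addrACA -scalerDr.
by rewrite [LHS]scalerDr !scalerA [_ * c]mulrC.
Qed.

Lemma half_linear (f : {linear E -> E}) : linear (fun x : E => (2^-1 : R[i]) *: (x - f x)).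
Proof.
by move=> c x y; rewrite linearP opprD addrACA -scalerBr [LHS]scalerDr !scalerA [_ * c]mulrC.
Qed.

Lemma half_double (x : E) : (2^-1 : R[i]) *: (x + x) = x.
Proof. lmod_eq. Qed.

Lemma iter_adj m x y : r (iter m V x) y = r x (iter m W y).
Proof. by elim: m x y => [//|m IH] x y; rewrite iterS V_adj IH -iterSr. Qed.

Lemma iter_isometry m x : iter m W (iter m V x) = x.
Proof. by elim: m => [//|m IH]; rewrite iterSr iterS V_isometry. Qed.

Lemma symbol_op_adj x y : r (symbol_op x) y = r x (symbol_adj y).
Proof.
rewrite rip_half iter_adj (ripDl hE) V_adj -(ripDr hE).
by rewrite [RHS](hilbertC hE) rip_half (hilbertC hE).
Qed.

Lemma half_adj x y : r (2^-1 *: (x - V x)) y = r x (2^-1 *: (y - W y)).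
Proof.
rewrite rip_half (ripBl hE) V_adj -(ripBr hE).
by rewrite [RHS](hilbertC hE) rip_half (hilbertC hE).
Qed.

(** Operator form of |1 + z|^2 + |1 - z|^2 = 4 on the unit circle, with W V = 1 in place of |z| =
    1. *)
Lemma symbol_isometry x :
  symbol_adj (symbol_op x) + 2^-1 *: (2^-1 *: (x - V x) - W (2^-1 *: (x - V x))) = x.
Proof.
rewrite /symbol_adj /symbol_op -scalerDr.
rewrite iterZ_linear iter_isometry !linearZZ.
rewrite !linearD !linearN /= !V_isometry; lmod_eq.
Qed.

Lemma symbol_defect_sym x y :
  r (symbol_op (symbol_adj x)) y = r x (symbol_op (symbol_adj y)).
Proof. by rewrite symbol_op_adj [RHS](hilbertC hE) symbol_op_adj (hilbertC hE). Qed.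

Lemma symbol_op_le x : N (symbol_op x) <= N x.
Proof.
apply: ler_wsqrtr; rewrite symbol_op_adj -[X in _ <= r x X]symbol_isometry.
by rewrite (ripDr hE) -half_adj lerDl (hilbert_ge0 hE).
Qed.

Lemma symbol_adj_le x : N (symbol_adj x) <= N x.
Proof.
have [->|Ny0] := eqVneq (N (symbol_adj x)) 0; first exact: sqrtr_ge0.
have Ny_gt0 : 0 < N (symbol_adj x) by rewrite lt_def Ny0 sqrtr_ge0.
rewrite -(ler_pM2r Ny_gt0) -expr2 (sqr_rnorm hE) -[leLHS]symbol_op_adj [leLHS](hilbertC hE).
apply: le_trans (rip_cauchy_schwarz hE _ _) _.
by rewrite ler_wpM2l ?sqrtr_ge0// symbol_op_le.
Qed.

Lemma sqrt_symbol_defect : exists A : {linear E -> E},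
  [/\ forall x y, r (A x) y = r x (A y), forall x, 0 <= r (A x) x,
      forall x, N (A x) <= 2 * N x &
      forall x, A (A x) = x - symbol_op (symbol_adj x)].
Proof.
pose C : {linear E -> E} :=
  linear_pack symbol_op_linear \o linear_pack symbol_adj_linear.
apply: (@sqrt_operator_ex _ _ _ hE C) => [x y|x]; first exact: symbol_defect_sym.
exact: le_trans (symbol_op_le _) (symbol_adj_le _).
Qed.

(** The terms V^j x with j < m are killed by W^m, and the leading coefficient of p_m is 1. *)
Lemma iterW_kernel_op m x : W x = 0 -> iter m W (kernel_op m x) = x.
Proof.
move=> Wx0; elim: m => [//|m IH].
by rewrite iterSr /= !linearD /= Wx0 !add0r V_isometry.
Qed.

(** W lowers each power of V by one and kills x, so the coefficients 2 cancel in pairs and the two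
    top powers remain. At m = 0 the lower one is W x = 0. *)
Lemma kernel_op_sub m x : W x = 0 ->
  kernel_op m x - W (kernel_op m x) = iter m V x + W (iter m V x).
Proof.
move=> Wx0; case: m => [|m] /=; first by rewrite Wx0 subr0 addr0.
rewrite !(linearD W) Wx0 !add0r !V_isometry.
elim: m => [|m IH] /=; first by lmod_eq.
by rewrite opprD addrACA subrr add0r -linearB IH linearD.
Qed.

(** Modulo the range of 1 - V every power of V acts as the identity, and p_m(1) = 2m + 1. *)
Lemma kernel_op_mod m x : exists y, kernel_op m x = x *+ m.*2.+1 + (y - V y).
Proof.
elim: m => [|m [y IH]]; first by exists 0; rewrite linear0 subr0 addr0 mulr1n.
exists (y - kernel_op m x); rewrite /= doubleS !mulrSr linearB [X in y - X - _]IH mulrSr; lmod_eq.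
Qed.


Lemma range_to_subspace_step y :
  (exists h k, W k = 0 /\ W y = (h - V h) + k) ->
  exists h k, W k = 0 /\ y = (h - V h) + k.
Proof.
move=> [h [k [Wk0 Wy]]].
exists (h - W y), (k + (y - V (W y))); split.
  by rewrite linearD linearB /= V_isometry Wk0 subrr addr0.
rewrite linearB /= [X in h - X - _]Wy; lmod_eq.
Qed.

Section Sqrt.
Context (A : {linear E -> E}).
Hypothesis A_sym : forall x y, r (A x) y = r x (A y).
Hypothesis AA : forall x, A (A x) = x - symbol_op (symbol_adj x).

Let B := linear_pack symbol_op_linear.
Let B' := linear_pack symbol_adj_linear.
Let a := linear_pack (half_linear V).
Let a' := linear_pack (half_linear W).

Let pair_of_range x : exists g, symbol_adj (A x) + 2^-1 *: (g - W g) = 0.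
Proof.
exact: (@pair_of_range _ _ _ hE A B B' a a' A_sym symbol_op_adj half_adj symbol_isometry AA).
Qed.

Let range_of_pair f g : symbol_adj f + 2^-1 *: (g - W g) = 0 -> exists x, A x = f.
Proof.
move/(@range_of_pair _ _ _ hE A B B' a a' A_sym symbol_op_adj half_adj symbol_isometry AA f g).
by move=> [x [_ [_ Axf]]]; exists x.
Qed.

Lemma pair_sub h :
  let g := iter n W (h + V h) in symbol_adj (h - V h) + 2^-1 *: (g - W g) = 0.
Proof.
move=> g; rewrite /symbol_adj /g -[W (iter n W (_ - _))]iterS iterSr.
rewrite -[W (iter n W (_ + _))]iterS iterSr.
rewrite !linearD !linearN /= !V_isometry !(iterB_linear, iterD_linear); lmod_eq.
Qed.

Lemma pair_kernel_op k : W k = 0 ->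
  symbol_adj (kernel_op n k) + 2^-1 *: (- k - W (- k)) = 0.
Proof.
move=> Wk0; rewrite /symbol_adj -scalerDr iterW_kernel_op// linearN Wk0.
by rewrite oppr0 subr0 addr0 subrr scaler0.
Qed.

Lemma range_decomposition f : (exists x, A x = f) <->
  exists h k, W k = 0 /\ f = (h - V h) + kernel_op n k.
Proof.
split=> [[x <-]|[h [k [Wk0 ->]]]].
  have [g] := pair_of_range x; move: (A x) => {}f; rewrite /symbol_adj => fg0.
  have {fg0} : exists h k, W k = 0 /\ iter n W f = (h - V h) + k.
    (* With this h, the image under W of the remainder is exactly the left side of the pair
       equation. *)
    pose h := 2^-1 *: (iter n W f + g); exists h, (iter n W f - (h - V h)); split.
      rewrite !(linearB W) V_isometry /h linearZZ (linearD W) -fg0; lmod_eq.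
    by rewrite addrC subrK.
  have H m : forall y, (exists h k, W k = 0 /\ iter m W y = (h - V h) + k) ->
      exists h k, W k = 0 /\ y = (h - V h) + k.
    elim: m => [//|m IH] y; rewrite iterSr => /IH.
    exact: range_to_subspace_step.
  move=> /H[h [k [Wk0 ->]]].
  (* Rescaled so that p(V) k' equals k modulo the range of 1 - V. *)
  pose k' := (n.*2.+1%:R : R[i])^-1 *: k.
  have [y Hy] := kernel_op_mod n k'.
  exists (h - y), k'; split; first by rewrite linearZZ Wk0 scaler0.
  rewrite Hy -scaler_nat scalerA divff ?pnatr_eq0// scale1r linearB; lmod_eq.
have [x1 Ax1] := range_of_pair (pair_sub h).
have [x2 Ax2] := range_of_pair (pair_kernel_op Wk0).
by exists (x1 + x2); rewrite linearD Ax1 Ax2.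
Qed.

Lemma range_orthogonal x1 x2 h k : orth_ker r A x2 -> W k = 0 ->
  A x1 = h - V h -> A x2 = kernel_op n k -> r x1 x2 = 0.
Proof.
move=> x2K Wk0 Ax1 Ax2.
have p1 := pair_sub h; have p2 := pair_kernel_op Wk0; rewrite -Ax1 in p1; rewrite -Ax2 in p2.
rewrite (@range_inner _ _ _ hE A B B' a a' A_sym symbol_op_adj half_adj
  symbol_isometry AA x1 x2 _ _ p1 p2 x2K).
  rewrite Ax1 Ax2 (ripNr hE) -[r (iter _ _ _) _](hilbertC hE) -iter_adj.
  rewrite (ripBl hE) V_adj -(ripBr hE) kernel_op_sub// [r (iter _ _ _) _](hilbertC hE).
  by rewrite (ripDl hE) V_adj -(ripDr hE) subrr.
move=> z /= az0; rewrite (ripNl hE).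
have /eqP Wz : z - W z = 0 by rewrite -[LHS]half_double scalerDr az0 addr0.
rewrite subr_eq0 in Wz.
(* A fixed vector of W is fixed by V, since |V z - z|^2 = 2 |z|^2 - 2 <z, W z> = 0. Hence <k, z> =
   <k, V z> = <W k, z> = 0, so k is orthogonal to ker a'. *)
have VzE : V z = z.
  apply/eqP; rewrite -subr_eq0; apply/eqP/(hilbert_eq0 hE).
  by rewrite (rip_sqrB hE) !V_adj V_isometry -(eqP Wz); ring.
by rewrite -VzE (hilbertC hE) V_adj Wk0 (rip0r hE) oppr0.
Qed.
End Sqrt.
End IsometryDefect.

(** * Integration of complex functions on the circle *)

Section ComplexIntegral.
Context (R : realType).
Local Notation m := (@circle_measure R).
Local Notation aef := (ae_filter_ringOfSetsType m).
Implicit Types F G : R -> R[i].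

Lemma circle_measureE : m setT = 1%E.
Proof.
rewrite /circle_measure /= /mrestr setTI lebesgue_measure_itv/= lte01.
by rewrite oppr0 adde0.
Qed.

Lemma Lfun2E (f : R -> R) : f \in Lfun m 2%:E <->
  measurable_fun setT f /\ m.-integrable setT (EFin \o (fun x => f x ^+ 2)).
Proof.
split=> [f2|[mf /integrableP[_ fi]]].
  split; last exact: Lfun2_integrable_sqr.
  by move: f2; rewrite inE => /andP[/[!inE]/=].
rewrite inE; apply/andP; split; rewrite inE//=.
rewrite /finite_norm unlock poweR_lty//; apply: le_lt_trans fi.
rewrite ge0_le_integral//.
- by move=> t _; exact: poweR_ge0.
- apply/measurable_EFinP; apply: (@measurableT_comp _ _ _ _ _ _ (fun x : R => x `^ 2)%R) => //.
  exact: measurableT_comp.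
- by apply: measurableT_comp => //; apply/measurable_EFinP; exact: measurable_funX.
- by move=> t _; rewrite /= lee_fin normrX powR_mulrn.
Qed.

Definition cmeasurable F := measurable_fun setT (fun t => complex.Re (F t)) /\
  measurable_fun setT (fun t => complex.Im (F t)).

Definition cintegrable F :=
  m.-integrable setT (EFin \o (fun t => complex.Re (F t))%R) /\
  m.-integrable setT (EFin \o (fun t => complex.Im (F t))%R).

Lemma cintegrable_measurable F : cintegrable F -> cmeasurable F.
Proof. by move=> [h1 h2]; split; apply/measurable_EFinP; exact: (measurable_int m). Qed.

Lemma cmeasurableM F G : cmeasurable F -> cmeasurable G ->
  cmeasurable (fun t => F t * G t).
Proof.
move=> [F1 F2] [G1 G2]; split.
- rewrite (_ : (fun t => _) = (fun t => complex.Re (F t) * complex.Re (G t) -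
    complex.Im (F t) * complex.Im (G t))).
    by apply: measurable_funB; exact: measurable_funM.
  by apply/funext => t; case: (F t) (G t) => [a b] [c d].
- rewrite (_ : (fun t => _) = (fun t => complex.Re (F t) * complex.Im (G t) +
    complex.Im (F t) * complex.Re (G t))).
    by apply: measurable_funD; exact: measurable_funM.
  by apply/funext => t; case: (F t) (G t) => [a b] [c d].
Qed.

Lemma cmeasurable_conj F : cmeasurable F -> cmeasurable (fun t => (F t)^*).
Proof.
move=> [F1 F2]; split.
- by rewrite (_ : (fun t => _) = (fun t => complex.Re (F t)))//; apply/funext => t; case: (F t).
- rewrite (_ : (fun t => _) = (fun t => - complex.Im (F t))).
    exact: measurableT_comp.
  by apply/funext => t; case: (F t).
Qed.

Lemma cmeasurableD F G : cmeasurable F -> cmeasurable G ->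
  cmeasurable (fun t => F t + G t).
Proof.
move=> [F1 F2] [G1 G2]; split.
- rewrite (_ : (fun t => _) = (fun t => complex.Re (F t) + complex.Re (G t))).
    exact: measurable_funD.
  by apply/funext => t; case: (F t) (G t) => [a b] [c d].
- rewrite (_ : (fun t => _) = (fun t => complex.Im (F t) + complex.Im (G t))).
    exact: measurable_funD.
  by apply/funext => t; case: (F t) (G t) => [a b] [c d].
Qed.

Lemma cmeasurable_cst (c : R[i]) : cmeasurable (fun=> c).
Proof. by split; exact: measurable_cst. Qed.

Lemma cLfun2E F : (F \in @cLfun2 R) =
  ((fun t => complex.Re (F t)) \in Lfun m 2%:E) &&
  ((fun t => complex.Im (F t)) \in Lfun m 2%:E).
Proof. by []. Qed.

Lemma cLfun2_measurable F : F \in @cLfun2 R -> cmeasurable F.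
Proof. by rewrite cLfun2E => /andP[/Lfun2E[? _] /Lfun2E[? _]]. Qed.

Lemma cLfun2_mul_integrable F G : F \in @cLfun2 R -> G \in @cLfun2 R ->
  cintegrable (fun t => F t * (G t)^*).
Proof.
rewrite !cLfun2E => /andP[F1 F2] /andP[G1 G2].
have H (f g : R -> R) : f \in Lfun m 2%:E -> g \in Lfun m 2%:E ->
    m.-integrable setT (EFin \o (fun t => f t * g t)%R).
  by move=> f2 g2; apply/Lfun1_integrable; exact: Lfun2_mul_Lfun1.
split.
- rewrite (_ : _ \o _ = ((EFin \o (fun t => complex.Re (F t) * complex.Re (G t))%R) \+
    (EFin \o (fun t => complex.Im (F t) * complex.Im (G t))%R))%E).
    by apply: integrableD => //; exact: H.
  apply/funext => t /=; rewrite -EFinD; congr EFin.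
  by case: (F t) (G t) => [a b] [c d] /=; rewrite mulrN opprK.
- rewrite (_ : _ \o _ = ((EFin \o (fun t => complex.Im (F t) * complex.Re (G t))%R) \-
    (EFin \o (fun t => complex.Re (F t) * complex.Im (G t))%R))%E).
    by apply: integrableB => //; exact: H.
  apply/funext => t /=; rewrite -EFinB; congr EFin.
  by case: (F t) (G t) => [a b] [c d] /=; rewrite mulrN addrC.
Qed.

Lemma ae_eq_cintegral F G : cmeasurable F -> cmeasurable G ->
  {ae m, forall t, F t = G t} -> cintegral F = cintegral G.
Proof.
move=> [F1 F2] [G1 G2] FG; rewrite /cintegral /Rintegral; congr (fine _ +i* fine _);
  apply: ae_eq_integral => //; try exact/measurable_EFinP;
  by apply: (@filterS _ _ aef _ _ _ FG) => t /= ->.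
Qed.

Lemma cintegralD F G : cintegrable F -> cintegrable G ->
  cintegral (fun t => F t + G t) = cintegral F + cintegral G.
Proof.
move=> [F1 F2] [G1 G2]; rewrite /cintegral.
rewrite -[RHS]/(_ +i* _) -!RintegralD//; congr (_ +i* _);
  by apply: eq_Rintegral => t _; case: (F t) (G t) => [a b] [c d].
Qed.

Lemma cintegrableD F G : cintegrable F -> cintegrable G ->
  cintegrable (fun t => F t + G t).
Proof.
move=> [F1 F2] [G1 G2]; split.
- rewrite (_ : _ \o _ = ((EFin \o (fun t => complex.Re (F t))%R) \+
    (EFin \o (fun t => complex.Re (G t))%R))%E); first exact: integrableD.
  by apply/funext => t /=; rewrite -EFinD; congr EFin; case: (F t) (G t) => [a b] [c d].
- rewrite (_ : _ \o _ = ((EFin \o (fun t => complex.Im (F t))%R) \+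
    (EFin \o (fun t => complex.Im (G t))%R))%E); first exact: integrableD.
  by apply/funext => t /=; rewrite -EFinD; congr EFin; case: (F t) (G t) => [a b] [c d].
Qed.

Lemma cintegrableZ (c : R[i]) F : cintegrable F -> cintegrable (fun t => c * F t).
Proof.
case: c => [a b] [F1 F2].
have H (x : R) (f : R -> R) : m.-integrable setT (EFin \o f) ->
    m.-integrable setT (EFin \o (fun t => x * f t)%R).
  move=> fi; rewrite (_ : _ \o _ = (fun t => x%:E * (f t)%:E)%E); first exact: integrableZl.
  by apply/funext => t /=; rewrite EFinM.
split.
- rewrite (_ : _ \o _ = ((EFin \o (fun t => a * complex.Re (F t))%R) \-
    (EFin \o (fun t => b * complex.Im (F t))%R))%E).
    by apply: integrableB => //; exact: H.
  by apply/funext => t /=; rewrite -EFinB; congr EFin; case: (F t).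
- rewrite (_ : _ \o _ = ((EFin \o (fun t => a * complex.Im (F t))%R) \+
    (EFin \o (fun t => b * complex.Re (F t))%R))%E).
    by apply: integrableD => //; exact: H.
  by apply/funext => t /=; rewrite -EFinD; congr EFin; case: (F t).
Qed.

Lemma cintegralZ (c : R[i]) F : cintegrable F ->
  cintegral (fun t => c * F t) = c * cintegral F.
Proof.
case: c => [a b] [F1 F2].
have H (x : R) (f : R -> R) : m.-integrable setT (EFin \o f) ->
    m.-integrable setT (EFin \o (fun t => x * f t)%R).
  move=> fi; rewrite (_ : _ \o _ = (fun t => x%:E * (f t)%:E)%E); first exact: integrableZl.
  by apply/funext => t /=; rewrite EFinM.
rewrite /cintegral -[RHS]/(_ +i* _) -!RintegralZl// -?RintegralB -?RintegralD//;
  try (exact: H); congr (_ +i* _);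
  by apply: eq_Rintegral => t _; case: (F t).
Qed.

Lemma cintegral_conj F : cintegrable F ->
  cintegral (fun t => (F t)^*) = (cintegral F)^*.
Proof.
move=> [F1 F2]; rewrite /cintegral -[RHS]/(_ +i* _); congr (_ +i* _).
  by apply: eq_Rintegral => t _; case: (F t).
rewrite -mulN1r -RintegralZl//.
by apply: eq_Rintegral => t _; case: (F t) => a b /=; rewrite mulN1r.
Qed.

Lemma le_cLfun2 (C : R) F G : cmeasurable F -> G \in @cLfun2 R ->
  {ae m, forall t, complex.Re (F t) ^+ 2 + complex.Im (F t) ^+ 2 <=
    C * (complex.Re (G t) ^+ 2 + complex.Im (G t) ^+ 2)} -> F \in @cLfun2 R.
Proof.
move=> [F1 F2]; rewrite !cLfun2E => /andP[/Lfun2E[G1 Gi1] /Lfun2E[G2 Gi2]] FG.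
have Gi : m.-integrable setT (EFin \o (fun t =>
    C * (complex.Re (G t) ^+ 2 + complex.Im (G t) ^+ 2))%R).
  rewrite (_ : _ \o _ = (fun t => C%:E * ((EFin \o (fun t => complex.Re (G t) ^+ 2)%R) \+
    (EFin \o (fun t => complex.Im (G t) ^+ 2)%R)) t)%E).
    by apply: integrableZl => //; exact: integrableD.
  by apply/funext => t /=; rewrite EFinM EFinD.
have H (f : R -> R) : measurable_fun setT f -> {ae m, forall t, f t ^+ 2 <=
    C * (complex.Re (G t) ^+ 2 + complex.Im (G t) ^+ 2)} -> f \in Lfun m 2%:E.
  move=> mf fG; apply/Lfun2E; split => //; apply/integrableP; split.
    by apply/measurable_EFinP; exact: measurable_funX.
  move/integrableP : Gi => [mG]; apply: le_lt_trans.
  apply: ae_ge0_le_integral => //.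
  - by apply: measurableT_comp => //; apply/measurable_EFinP; exact: measurable_funX.
  - exact: measurableT_comp.
  - apply: (@filterS _ _ aef _ _ _ fG) => t ft _ /=.
    rewrite lee_fin ger0_norm ?sqr_ge0// (le_trans ft)//.
    exact: ler_norm.
apply/andP; split; apply: H => //; apply: (@filterS _ _ aef _ _ _ FG) => t /=.
  by have := sqr_ge0 (complex.Im (F t)); lra.
by have := sqr_ge0 (complex.Re (F t)); lra.
Qed.
End ComplexIntegral.

(** * The Hilbert space L2 *)

Section L2Space.
Local Open Scope quotient_scope.
Context (R : realType).
Local Notation m := (@circle_measure R).
Local Notation aef := (ae_filter_ringOfSetsType m).
Local Notation L2 := (L2 R).
Implicit Types (f g h : L2) (F G : R -> R[i]).

Lemma L2_fun_cLfun2 f : L2_fun f \in @cLfun2 R.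
Proof. by rewrite /L2_fun; case: (repr f). Qed.

Lemma L2_fun_pi (F : preL2 R) : {ae m, forall t, L2_fun (\pi_L2 F) t = F t}.
Proof.
have : (repr (\pi_L2 F) - F) \in @ae_null R.
  by rewrite Quotient.idealrBE reprK.
move=> /asboolP; apply: (@filterS _ _ aef) => t.
by rewrite -[_ t]/(repr (\pi_L2 F) t - F t) => /eqP; rewrite subr_eq0 => /eqP.
Qed.

Lemma L2_eq f g : {ae m, forall t, L2_fun f t = L2_fun g t} -> f = g.
Proof.
move=> fg; rewrite -[f]reprK -[g]reprK; apply/eqP.
rewrite piE Quotient.equivE; apply/asboolP.
apply: (@filterS _ _ aef _ _ _ fg) => t.
by rewrite /L2_fun => h; rewrite -[LHS]/(repr f t - repr g t) h subrr.
Qed.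

(** Functions that are not square integrable go to 0, as in [mult], which unfolds to [to_L2] of a
    pointwise product. *)
Definition to_L2 F : L2 := \pi_L2 (insubd (0 : preL2 R) F).

Lemma L2_fun_to F : F \in @cLfun2 R -> {ae m, forall t, L2_fun (to_L2 F) t = F t}.
Proof.
move=> F2; have := L2_fun_pi (insubd (0 : preL2 R) F).
apply: (@filterS _ _ aef) => t; rewrite /to_L2 => ->.
by rewrite -[preL2_fun _]/(val _) insubdK.
Qed.

Lemma L2_funD f g : {ae m, forall t, L2_fun (f + g) t = L2_fun f t + L2_fun g t}.
Proof.
have := L2_fun_pi (repr f + repr g).
rewrite raddfD /= !reprK; exact.
Qed.

Lemma L2_funZ (a : R[i]) f : {ae m, forall t, L2_fun (a *: f) t = a * L2_fun f t}.
Proof.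
have := L2_fun_pi (a *: repr f).
rewrite pi_L2Z reprK; exact.
Qed.

Lemma inner_ae f g F G : F \in @cLfun2 R -> G \in @cLfun2 R ->
  {ae m, forall t, L2_fun f t = F t} -> {ae m, forall t, L2_fun g t = G t} ->
  inner f g = cintegral (fun t => F t * (G t)^*).
Proof.
move=> F2 G2 fF gG; apply: ae_eq_cintegral.
- by apply/cintegrable_measurable/cLfun2_mul_integrable; exact: L2_fun_cLfun2.
- exact/cintegrable_measurable/cLfun2_mul_integrable.
- by apply: (@filterS2 _ _ aef _ _ _ _ fF gG) => t -> ->.
Qed.

Lemma innerDl f g h : inner (f + g) h = inner f h + inner g h.
Proof.
rewrite /inner -cintegralD; try by apply: cLfun2_mul_integrable; exact: L2_fun_cLfun2.
apply: ae_eq_cintegral.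
- by apply/cintegrable_measurable/cLfun2_mul_integrable; exact: L2_fun_cLfun2.
- apply/cintegrable_measurable/cintegrableD;
  by apply/cLfun2_mul_integrable; exact: L2_fun_cLfun2.
- by apply: (@filterS _ _ aef _ _ _ (L2_funD f g)) => t ->; rewrite mulrDl.
Qed.

Lemma innerZl (a : R[i]) f h : inner (a *: f) h = a * inner f h.
Proof.
rewrite /inner -cintegralZ; last by apply: cLfun2_mul_integrable; exact: L2_fun_cLfun2.
apply: ae_eq_cintegral.
- by apply/cintegrable_measurable/cLfun2_mul_integrable; exact: L2_fun_cLfun2.
- by apply/cintegrable_measurable/cintegrableZ/cLfun2_mul_integrable; exact: L2_fun_cLfun2.
- by apply: (@filterS _ _ aef _ _ _ (L2_funZ a f)) => t ->; rewrite mulrA.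
Qed.

Lemma inner_conj f g : inner g f = (inner f g)^*.
Proof.
rewrite /inner -cintegral_conj; last by apply: cLfun2_mul_integrable; exact: L2_fun_cLfun2.
congr cintegral; apply/funext => t.
by case: (L2_fun f t) (L2_fun g t) => [a b] [c d]; simpc; congr (_ +i* _); ring.
Qed.

Lemma innerZr (a : R[i]) f h : inner h (a *: f) = a^* * inner h f.
Proof. by rewrite inner_conj innerZl [in RHS]inner_conj; exact: rmorphM. Qed.

Lemma innerDr f g h : inner h (f + g) = inner h f + inner h g.
Proof.
rewrite inner_conj innerDl [inner h f]inner_conj [inner h g]inner_conj.
exact: rmorphD.
Qed.

Lemma Re_inner_self f : complex.Re (inner f f) =
  \int[m]_t (complex.Re (L2_fun f t) ^+ 2 + complex.Im (L2_fun f t) ^+ 2).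
Proof.
apply: eq_Rintegral => t _; case: (L2_fun f t) => a b /=.
by rewrite mulrN opprK !expr2.
Qed.

Definition re_inner f g : R := complex.Re (inner f g).

Lemma inner_re f g : inner f g = re_inner f g +i* re_inner f ('i *: g).
Proof.
rewrite /re_inner innerZr; case: (inner f g) => a b.
by simpc; congr (_ +i* _) => /=; ring.
Qed.

Lemma sqr_integrable f : m.-integrable setT (EFin \o (fun t =>
  complex.Re (L2_fun f t) ^+ 2 + complex.Im (L2_fun f t) ^+ 2)).
Proof.
have [h _] := cLfun2_mul_integrable (L2_fun_cLfun2 f) (L2_fun_cLfun2 f).
apply: eq_integrable h => // t _ /=; case: (L2_fun f t) => a b /=.
by rewrite mulrN opprK !expr2.
Qed.

Lemma re_inner_eq0 f : re_inner f f = 0 -> f = 0.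
Proof.
rewrite /re_inner Re_inner_self => rf0; have := congr1 EFin rf0.
rewrite /Rintegral fineK; last exact/integrable_fin_num/sqr_integrable.
move=> f0; have : {ae m, forall t, setT t ->
    (complex.Re (L2_fun f t) ^+ 2 + complex.Im (L2_fun f t) ^+ 2)%:E = 0%E}.
  apply/(ae_eq_integral_abs m measurableT); first exact: measurable_int (sqr_integrable f).
  rewrite -[RHS]f0; apply: eq_integral => t _.
  by rewrite gee0_abs// lee_fin addr_ge0 ?sqr_ge0.
(* The chosen representative of the zero class vanishes only almost everywhere; this is read off
   from 0 *: f. *)
move=> {}f0; have L20 := L2_funZ 0 f; rewrite scale0r in L20.
apply: L2_eq; apply: (@filterS2 _ _ aef _ _ _ _ f0 L20) => t /(_ I) [] ft ->.
rewrite mul0r; move/eqP : ft; case: (L2_fun f t) => a b /=.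
by rewrite paddr_eq0 ?sqr_ge0// !sqrf_eq0 => /andP[/eqP-> /eqP->].
Qed.
End L2Space.

(** * Completeness of L2 (Riesz-Fischer) *)

Section FastCauchy.
Context d (T : measurableType d) (R : realType) (mu : {measure set T -> \bar R}).

(** The increments have summable L^1 norms, so the sum of their absolute values is integrable, hence
    finite almost everywhere, and the telescoping series converges absolutely there. *)
Lemma fast_cauchy_ae_cvg (h : nat -> T -> R) :
  (forall k, measurable_fun setT (h k)) ->
  (forall k, (\int[mu]_t `|h k.+1 t - h k t|%:E <= (1 / (2 ^ k.+1)%:R)%:E)%E) ->
  exists H : T -> R, measurable_fun setT H /\
    {ae mu, forall t, h ^~ t @ \oo --> H t}.
Proof.
move=> mh hle; pose D k t := `|h k.+1 t - h k t|%:E.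
have mD k : measurable_fun setT (D k).
  apply/measurable_EFinP/measurableT_comp => //.
  exact: measurable_funB.
have D0 k t : (0 <= D k t)%E by rewrite lee_fin.
pose g t := (\sum_(k <oo) D k t)%E.
have g0 t : (0 <= g t)%E by exact: nneseries_ge0.
have mg : measurable_fun setT g by exact: ge0_emeasurable_sum.
have gi : mu.-integrable setT g.
  apply/integrableP; split => //.
  under eq_integral do rewrite gee0_abs//.
  rewrite integral_nneseries// (@le_lt_trans _ _ 1%E) ?ltry//.
  apply: le_trans (epsilon_trick0 xpredT ler01).
  by apply: lee_nneseries => k *; [exact: integral_ge0|exact: hle].
(* The upper limit is defined and measurable everywhere, including where the sequence diverges. *)
exists (fun t => fine (limn_esup (fun k => (h k t)%:E))); split.
  apply: (measurableT_comp (@fine_measurable _ setT measurableT)) => //.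
  by apply: measurable_fun_limn_esup => k; exact/measurable_EFinP.
have := integrable_ae measurableT gi; apply: filterS => t /(_ I) gt.
have cd : cvgn [normed series (telescope (h ^~ t))].
  rewrite [X in cvgn X](_ : _ = fun n => \sum_(0 <= k < n) `|h k.+1 t - h k t|)//.
  apply: nondecreasing_is_cvgn.
    by apply/nondecreasing_seqP => n; rewrite big_nat_recr//= lerDl.
  exists (fine (g t)) => _ [n _ <-].
  rewrite -lee_fin fineK// -sumEFin.
  exact: nneseries_lim_ge.
have /cvg_ex[l hl] : cvgn (h ^~ t).
  rewrite (_ : h ^~ t = cst (h 0%N t) + series (telescope (h ^~ t))).
    by apply: is_cvgD; [exact: is_cvg_cst|exact: normed_cvg].
  by apply/funext => n; rewrite [LHS](eq_sum_telescope (h ^~ t)).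
have el : (fun k => (h k t)%:E) @ \oo --> l%:E by apply: cvg_EFin => //; exact: nearW.
rewrite is_cvg_limn_esupE; last by apply/cvg_ex; exists l%:E.
by rewrite (cvg_lim _ el).
Qed.
End FastCauchy.

Section L2Complete.
Context (R : realType).
Local Notation m := (@circle_measure R).
Local Notation aef := (ae_filter_ringOfSetsType m).
Local Notation L2 := (L2 R).
Local Notation q x := (re_inner x x).

Definition sqmod (z : R[i]) : R := complex.Re z ^+ 2 + complex.Im z ^+ 2.

Lemma sqmod_ge0 z : 0 <= sqmod z.
Proof. by rewrite addr_ge0 ?sqr_ge0. Qed.

Lemma sqmod_measurable (F : R -> R[i]) : cmeasurable F ->
  measurable_fun setT (fun t => sqmod (F t)).
Proof. by move=> [F1 F2]; apply: measurable_funD; exact: measurable_funX. Qed.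

Lemma sqr_normE (f : L2) (F : R -> R[i]) : cmeasurable F ->
  {ae m, forall t, L2_fun f t = F t} ->
  (q f)%:E = (\int[m]_t (sqmod (F t))%:E)%E.
Proof.
move=> mF fF; rewrite /re_inner Re_inner_self /Rintegral fineK; last first.
  exact/integrable_fin_num/sqr_integrable.
apply: ae_eq_integral => //.
- apply/measurable_EFinP; exact: (sqmod_measurable (cLfun2_measurable (L2_fun_cLfun2 f))).
- apply/measurable_EFinP; exact: sqmod_measurable.
- by apply: (@filterS _ _ aef _ _ _ fF) => t ->.
Qed.

Lemma L2_funB (f g : L2) : {ae m, forall t, L2_fun (f - g) t = L2_fun f t - L2_fun g t}.
Proof.
have := L2_funD f (- g); have := L2_funZ (-1) g.
by apply: (@filterS2 _ _ aef) => t; rewrite scaleN1r mulN1r => -> ->.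
Qed.

Lemma L2_fast_subsequence (u : nat -> L2) : cauchy_seq (@re_inner R) u ->
  exists v : nat -> nat, (forall k, (k <= v k)%N) /\
    forall k, q (u (v k.+1) - u (v k)) < ((2 ^ k.+1)%:R^-1) ^+ 2.
Proof.
move=> uC.
have /choice[M hM] : forall k : nat, exists M, forall a b, (M <= a)%N -> (M <= b)%N ->
    q (u a - u b) < ((2 ^ k.+1)%:R^-1) ^+ 2.
  by move=> k; apply: uC; rewrite exprn_gt0// invr_gt0 ltr0n expn_gt0.
(* The maximum over i <= k makes v k at least k and keeps v k.+1 above the threshold M k too. *)
exists (fun k => \max_(i < k.+1) maxn i (M i)); split=> k.
  by apply: leq_trans (leq_bigmax (ord_max : 'I_k.+1)); rewrite leq_maxl.
have H j : (k <= j)%N -> (M k <= \max_(i < j.+1) maxn i (M i))%N.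
  move=> kj; have kj1 : (k < j.+1)%N by [].
  by apply: leq_trans (leq_bigmax (Ordinal kj1)); rewrite leq_maxr.
by apply: hM; exact: H.
Qed.

Lemma L2_fast_component (u : nat -> L2) (p : R[i] -> R) :
  (forall z w, p (z - w) = p z - p w) -> (forall z, p z ^+ 2 <= sqmod z) ->
  (forall F, cmeasurable F -> measurable_fun setT (fun t => p (F t))) ->
  (forall k, q (u k.+1 - u k) < ((2 ^ k.+1)%:R^-1) ^+ 2) ->
  exists H : R -> R, measurable_fun setT H /\
    {ae m, forall t, (fun k => p (L2_fun (u k) t)) @ \oo --> H t}.
Proof.
move=> pB p_le mp uC.
apply: (@fast_cauchy_ae_cvg _ _ _ m (fun k t => p (L2_fun (u k) t))).
  by move=> k; apply: mp; exact/cLfun2_measurable/L2_fun_cLfun2.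
(* With this weight each of the two terms of the AM-GM bound integrates to at most 1 / (2c), the
   circle having mass 1. *)
move=> k; set c : R := (2 ^ k.+1)%:R.
have c0 : 0 < c by rewrite ltr0n expn_gt0.
have mF n : cmeasurable (L2_fun (u n)) by exact/cLfun2_measurable/L2_fun_cLfun2.
have mpB : measurable_fun setT (fun t => p (L2_fun (u k.+1) t) - p (L2_fun (u k) t)).
  by apply: measurable_funB; exact: mp.
(* AM-GM: |x| <= (c x^2 + 1 / c) / 2 *)
have mB := sqmod_measurable (cLfun2_measurable (L2_fun_cLfun2 (u k.+1 - u k))).
apply: (@le_trans _ _ (\int[m]_t ((c / 2)%:E *
    (sqmod (L2_fun (u k.+1 - u k) t))%:E + (c^-1 / 2)%:E))%E).
  apply: ae_ge0_le_integral => //.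
  - by apply/measurable_EFinP/measurableT_comp.
  - move=> t _; rewrite -EFinM -EFinD lee_fin.
    by rewrite addr_ge0 ?mulr_ge0 ?sqmod_ge0 ?divr_ge0 ?invr_ge0 ?ltW.
  - apply: emeasurable_funD => //; apply: emeasurable_funM => //.
    exact/measurable_EFinP.
  apply: (@filterS _ _ aef _ _ _ (L2_funB (u k.+1) (u k))) => t -> _.
  rewrite -EFinM -EFinD lee_fin -pB; set z := _ - _.
  have := p_le z; have := sqr_ge0 (c * `|p z| - 1).
  rewrite sqrrB mulr1 expr1n exprMn real_normK ?num_real// mulr2n => h1 h2.
  rewrite -(ler_pM2l c0).
  rewrite mulrDr [c * (c^-1 / 2)]mulrA divff ?gt_eqF//.
  have : c ^+ 2 * p z ^+ 2 <= c ^+ 2 * sqmod z by rewrite ler_wpM2l ?sqr_ge0.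
  by move: (sqmod z) (p z ^+ 2) (`|p z|) h1 => a b e; rewrite expr2; lra.
rewrite ge0_integralD//; first last.
- by move=> t _; rewrite lee_fin divr_ge0 ?invr_ge0 ?ltW.
- by apply: emeasurable_funM => //; exact/measurable_EFinP.
- by move=> t _; rewrite -EFinM lee_fin mulr_ge0 ?sqmod_ge0 ?divr_ge0 ?ltW.
rewrite ge0_integralZl//; first last.
- by rewrite lee_fin divr_ge0// ltW.
- by move=> t _; rewrite lee_fin sqmod_ge0.
- exact/measurable_EFinP.
rewrite -(@sqr_normE (u k.+1 - u k))//; first last.
- exact: (@nearW _ _ _ aef).
- exact/cLfun2_measurable/L2_fun_cLfun2.
rewrite integral_cst// circle_measureE mule1 -EFinM -EFinD lee_fin.
have := uC k; rewrite -/c; move: (q _) => x xc.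
have : c / 2 * x <= c / 2 * (c^-1 ^+ 2) by rewrite ler_wpM2l ?divr_ge0 ?ltW.
have -> : c / 2 * (c^-1 ^+ 2) = c^-1 / 2 by field; rewrite gt_eqF.
by rewrite div1r; move: (c^-1) (c / 2 * x) => ? ?; lra.
Qed.

Lemma sqmod_cLfun2 (F : R -> R[i]) : cmeasurable F ->
  (\int[m]_t (sqmod (F t))%:E < +oo)%E -> F \in @cLfun2 R.
Proof.
move=> mF Foo; have [F1 F2] := mF; rewrite cLfun2E.
have H (f : R -> R) : measurable_fun setT f -> (forall t, f t ^+ 2 <= sqmod (F t)) ->
    f \in Lfun m 2%:E.
  move=> mf fF; apply/Lfun2E; split => //; apply/integrableP; split.
    by apply/measurable_EFinP; exact: measurable_funX.
  apply: le_lt_trans Foo; apply: ge0_le_integral => //.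
  - by apply/measurable_EFinP/measurableT_comp => //; exact: measurable_funX.
  - by apply/measurable_EFinP; exact: sqmod_measurable.
  - by move=> t _; rewrite /= lee_fin ger0_norm ?sqr_ge0.
by apply/andP; split; apply: H => // t; rewrite ?lerDl ?lerDr sqr_ge0.
Qed.

Lemma sqmodN z : sqmod (- z) = sqmod z.
Proof. by case: z => a b; rewrite /sqmod /= !sqrrN. Qed.

Lemma measurable_limn_einf (f : nat -> R -> \bar R) :
  (forall n, measurable_fun setT (f n)) ->
  measurable_fun setT (fun t => limn_einf (f ^~ t)).
Proof.
move=> mf; apply: (measurableT_comp (@oppe_measurable R setT)).
by apply: measurable_fun_limn_esup => n; exact: measurableT_comp.
Qed.

(** A fast subsequence provides the pointwise limit F. Fatou's lemma along it bounds the distance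
    from F to every late term of u, so the whole sequence converges. *)
Lemma L2_complete (u : nat -> L2) : cauchy_seq (@re_inner R) u ->
  exists l, converges (@re_inner R) u l.
Proof.
move=> uC; have [v [vk vC]] := L2_fast_subsequence uC.
have ReB (z w : R[i]) : complex.Re (z - w) = complex.Re z - complex.Re w.
  by case: z w => [a b] [c d].
have ImB (z w : R[i]) : complex.Im (z - w) = complex.Im z - complex.Im w.
  by case: z w => [a b] [c d].
have Re_le z : complex.Re z ^+ 2 <= sqmod z by rewrite lerDl sqr_ge0.
have Im_le z : complex.Im z ^+ 2 <= sqmod z by rewrite lerDr sqr_ge0.
have mRe F : cmeasurable F -> measurable_fun setT (fun t : R => complex.Re (F t)) by case.
have mIm F : cmeasurable F -> measurable_fun setT (fun t : R => complex.Im (F t)) by case.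
have [H1 [mH1 cH1]] := @L2_fast_component (u \o v) (@complex.Re R) ReB Re_le mRe vC.
have [H2 [mH2 cH2]] := @L2_fast_component (u \o v) (@complex.Im R) ImB Im_le mIm vC.
pose F t := H1 t +i* H2 t.
have mF : cmeasurable F by [].
have mu n : cmeasurable (L2_fun (u n)) by exact/cLfun2_measurable/L2_fun_cLfun2.
have muN n : cmeasurable (fun t => - L2_fun (u n) t).
  by have := cmeasurableM (cmeasurable_cst (-1)) (mu n); under eq_fun do rewrite mulN1r.
have key e : 0 < e -> exists M, forall n, (M <= n)%N ->
    (\int[m]_t (sqmod (F t - L2_fun (u n) t))%:E <= e%:E)%E.
  move=> e0; have [M hM] := uC e e0; exists M => n Mn.
  (* The shift by M makes every index at least M, so that the Cauchy bound applies for all k. *)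
  pose f k t := (sqmod (L2_fun (u (v (k + M)%N)) t - L2_fun (u n) t))%:E.
  have mf k : measurable_fun setT (f k).
    by apply/measurable_EFinP; apply: sqmod_measurable; exact: cmeasurableD.
  have f0 k t : (0 <= f k t)%E by rewrite lee_fin sqmod_ge0.
  have -> : (\int[m]_t (sqmod (F t - L2_fun (u n) t))%:E = \int[m]_t limn_einf (f ^~ t))%E.
   apply: ae_eq_integral => //; first last.
  - apply: (@filterS2 _ _ aef _ _ _ _ cH1 cH2) => t c1 c2 _.
    have c : (fun k => sqmod (L2_fun (u (v k)) t - L2_fun (u n) t)) @ \oo -->
        sqmod (F t - L2_fun (u n) t).
      rewrite /sqmod; under eq_fun do rewrite ReB ImB; rewrite ReB ImB.
      have sqc (w : nat -> R) (l : R) : w @ \oo --> l -> (fun k => w k ^+ 2) @ \oo --> (l ^+ 2 : R).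
        by move=> wl; apply: (cvg_comp _ (fun x => x ^+ 2) wl); exact: exprn_continuous.
      by apply: cvgD; apply: sqc; apply: cvgB => //; exact: cvg_cst.
    have {}c : (f ^~ t) @ \oo --> (sqmod (F t - L2_fun (u n) t))%:E.
      apply: cvg_EFin; first exact: nearW.
      by move: c; rewrite -(cvg_shiftn M).
    by rewrite is_cvg_limn_einfE ?(cvg_lim _ c)//; apply/cvg_ex; eexists; exact: c.
  - exact: measurable_limn_einf.
  - by apply/measurable_EFinP; apply: sqmod_measurable; exact: cmeasurableD.
  apply: (le_trans (@fatou _ _ _ m setT measurableT f mf (fun n x _ => f0 n x))).
  rewrite limn_einf_lim; apply: lime_le; first exact: is_cvg_einfs.
  apply: nearW => k; apply: (@le_trans _ _ (\int[m]_t f k t)%E).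
    by apply: ereal_inf_lbound; exists k => //=.
  rewrite -(@sqr_normE (u (v (k + M)%N) - u n)); first last.
  - exact: L2_funB.
  - exact: cmeasurableD.
  by rewrite lee_fin ltW// hM// (leq_trans _ (vk _))// leq_addl.
have F2 : F \in @cLfun2 R.
  have [M hM] := key 1 ltr01.
  have G2 : (fun t => F t - L2_fun (u M) t) \in @cLfun2 R.
    apply: sqmod_cLfun2; first exact: cmeasurableD.
    by rewrite (le_lt_trans (hM M _))// ltry.
  have := rpredD G2 (L2_fun_cLfun2 (u M)).
  by rewrite (_ : _ + _ = F)//; apply/funext => t; rewrite !fctE subrK.
exists (to_L2 F); apply/cvgrPdist_le => e e0.
have [M hM] := key e e0; exists M => // n /= Mn.
rewrite sub0r normrN ger0_norm; last first.
  by rewrite /re_inner Re_inner_self; apply: Rintegral_ge0 => t _; exact: sqmod_ge0.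
rewrite -lee_fin (@sqr_normE _ (fun t => L2_fun (u n) t - F t)).
- by apply: le_trans (hM n Mn); under eq_integral do rewrite -sqmodN opprB.
- apply: cmeasurableD => //.
  by have := cmeasurableM (cmeasurable_cst (-1)) mF; under eq_fun do rewrite mulN1r.
- apply: (@filterS2 _ _ aef _ _ _ _ (L2_funB (u n) (to_L2 F)) (L2_fun_to F2)) => t -> ->.
  by [].
Qed.

Lemma L2_hilbert : hilbert (@re_inner R).
Proof.
split.
- by move=> f g h; rewrite /re_inner innerDl; case: (inner f h) (inner g h) => [a b] [c d].
- by move=> a f g; rewrite /re_inner innerZl; case: (inner f g) => b c; simpc.
- move=> f g; rewrite /re_inner innerZl innerZr; case: (inner f g) => a b.
  by simpc => /=; ring.
- by move=> f g; rewrite /re_inner inner_conj; case: (inner g f).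
- by move=> f; rewrite /re_inner Re_inner_self; apply: Rintegral_ge0 => t _; exact: sqmod_ge0.
- exact: re_inner_eq0.
- exact: L2_complete.
Qed.
End L2Complete.

(** * Fourier modes *)

Section Fourier.
Context (R : realType).
Local Notation m := (@circle_measure R).
Local Notation aef := (ae_filter_ringOfSetsType m).
Local Notation L2 := (L2 R).
Local Notation mu := (@lebesgue_measure R).
Local Notation e_ := (@fourier_mode R).

Lemma circle_integral (f : R -> \bar R) : measurable_fun setT f ->
  (\int[m]_t f t = \int[mu]_(t in `[0%R, 1%R[) f t)%E.
Proof.
move=> mf; pose D : set (measurableTypeR R) := `[0%R, 1%R[%classic.
have mD : measurable D by exact: measurable_itv.
transitivity (\int[m]_(t in D) f t)%E.
  rewrite [RHS]integral_mkcond; apply: ae_eq_integral => //.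
    by apply: (measurable_restrictT _ _).1 => //; exact: measurable_funS mf.
  exists (~` D); split; first exact: measurableC.
    by rewrite /circle_measure /= /mrestr setICl measure0.
  move=> t /= h Dt; apply: h => _.
  by rewrite patchE mem_set.
apply: eq_measure_integral => A mA A01.
by rewrite /circle_measure /= /mrestr setIidl.
Qed.

Lemma mode_measurable k : cmeasurable (e_ k).
Proof.
split; rewrite /fourier_mode /=.
- apply: (measurableT_comp (continuous_measurable_fun (@continuous_cos R))); exact: measurable_funM.
- apply: (measurableT_comp (continuous_measurable_fun (@continuous_sin R))); exact: measurable_funM.
Qed.

Lemma mode0 t : e_ 0 t = 1.
Proof. by rewrite /fourier_mode mulr0 mul0r cos0 sin0. Qed.

Lemma modeD j k t : e_ (j + k) t = e_ j t * e_ k t.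
Proof.
rewrite /fourier_mode intrD mulrDr mulrDl cosD sinD; simpc.
by congr (_ +i* _); rewrite addrC.
Qed.

Lemma modeN k t : e_ (- k) t = (e_ k t)^*.
Proof. by rewrite /fourier_mode /= mulrNz mulrN mulNr cosN sinN. Qed.

Lemma modeB j k t : e_ (j - k) t = e_ j t * (e_ k t)^*.
Proof. by rewrite modeD modeN. Qed.

Lemma sqmodM (z w : R[i]) : sqmod (z * w) = sqmod z * sqmod w.
Proof. by case: z w => [a b] [c d]; rewrite /sqmod /=; ring. Qed.

Lemma sqmod_mode k t : sqmod (e_ k t) = 1.
Proof. by rewrite /sqmod /= addrC sin2cos2 subrK. Qed.

Lemma cst_cLfun2 (c : R[i]) : (fun=> c) \in @cLfun2 R.
Proof.
apply: sqmod_cLfun2; first exact: cmeasurable_cst.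
by rewrite integral_cst// circle_measureE mule1 ltry.
Qed.

Lemma mul_cLfun2 (C : R) (F G : R -> R[i]) : cmeasurable F ->
  {ae m, forall t, sqmod (F t) <= C} -> G \in @cLfun2 R ->
  (fun t => F t * G t) \in @cLfun2 R.
Proof.
move=> mF FC G2; apply: (@le_cLfun2 R C _ _ _ G2).
  by apply: cmeasurableM => //; exact: cLfun2_measurable.
apply: (@filterS _ _ aef _ _ _ FC) => t FtC.
by rewrite -/(sqmod (F t * G t)) sqmodM ler_wpM2r ?sqmod_ge0.
Qed.

Lemma mode_cLfun2 k : e_ k \in @cLfun2 R.
Proof.
apply: sqmod_cLfun2; first exact: mode_measurable.
under eq_integral do rewrite sqmod_mode.
by rewrite integral_cst// circle_measureE mule1 ltry.
Qed.

Definition mode (k : int) : L2 := to_L2 (e_ k).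

Lemma inner_mode f k : inner f (mode k) = fourier_coef (L2_fun f) k.
Proof.
apply: inner_ae; first exact: L2_fun_cLfun2.
- exact: mode_cLfun2.
- exact: (@nearW _ _ _ aef).
- exact/L2_fun_to/mode_cLfun2.
Qed.

Lemma mode_at1 k : e_ k 1 = 1.
Proof.
have e1 : e_ 1 1 = 1.
  rewrite /fourier_mode !mulr1 mulr_natl mulr2n (cosD pi pi) (sinD pi pi) cospi sinpi.
  by rewrite !(mulr0, mul0r) subr0 addr0 mulrNN mulr1.
have H (n : nat) : e_ n 1 = 1.
  by elim: n => [|n IH]; [rewrite mode0|rewrite -addn1 PoszD modeD IH e1 mulr1].
by case: k => n; [exact: H|rewrite NegzE modeN H conjc1].
Qed.

(** The antiderivatives sin(w t) / w and - cos(w t) / w take equal values at 0 and 1, since w is a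
    multiple of 2 pi. *)
Lemma cos_sin_integral0 (k : int) : k != 0 ->
  \int[m]_t cos (2 * pi * k%:~R * t) = 0 /\ \int[m]_t sin (2 * pi * k%:~R * t) = 0.
Proof.
move=> k0; set w : R := 2 * pi * k%:~R.
have w0 : w != 0 by rewrite mulf_neq0 ?intr_eq0// mulf_neq0// gt_eqF ?pi_gt0.
have [cosw sinw] : cos w = 1 /\ sin w = 0.
  by have [] := mode_at1 k; rewrite mulr1.
have H (f F : R -> R) : continuous f -> (forall t : R, is_derive t 1 F (f t)) -> F 0 = F 1 ->
    measurable_fun setT f -> \int[m]_t f t = 0.
  move=> cf dF F01 mf.
  have cF : continuous F.
    move=> x; apply: differentiable_continuous; apply/derivable1_diffP.
    by have [] := dF x.
  rewrite /Rintegral circle_integral; last exact/measurable_EFinP.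
  rewrite integral_itv_bndo_bndc; last first.
    by apply/measurable_EFinP; exact: measurable_funS mf.
  rewrite (@continuous_FTC2 _ f F)// ?F01 ?subee//.
  - exact: continuous_subspaceT.
  - split=> [x _||].
    + by have [] := dF x.
    + by apply: cvg_at_right_filter; exact: cF.
    + by apply: cvg_at_left_filter; exact: cF.
  - by move=> x _; rewrite derive1E; have [] := dF x.
have cw : continuous (fun t : R => w * t) by move=> t; exact: mulrl_continuous.
split.
- apply: (H _ (w^-1 \*: (@sin R \o *:%R w))).
  + by move=> t; apply: continuous_comp; [exact: cw|exact: continuous_cos].
  + move=> t.
    have D := is_deriveZ w^-1 (is_derive1_comp
      (is_derive_sin (w *: t)) (is_deriveZ w (is_derive_id t 1))).
    rewrite (_ : cos (w * t) = w^-1 *: (cos (w *: t) * w%:A)); first exact: D.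
    by rewrite -[w *: t]/(w * t) -[w%:A]/(w * 1) -[RHS]/(w^-1 * (cos (w * t) * (w * 1))); field.
  + by rewrite /= -[w *: 0]/(w * 0) -[w *: 1]/(w * 1) mulr0 mulr1 sinw sin0.
  + exact: (mode_measurable k).1.
- apply: (H _ ((- w^-1) \*: (@cos R \o *:%R w))).
  + by move=> t; apply: continuous_comp; [exact: cw|exact: continuous_sin].
  + move=> t.
    have D := is_deriveZ (- w^-1) (is_derive1_comp
      (is_derive_cos (w *: t)) (is_deriveZ w (is_derive_id t 1))).
    rewrite (_ : sin (w * t) = - w^-1 *: (- sin (w *: t) * w%:A)); first exact: D.
    by rewrite -[w *: t]/(w * t) -[w%:A]/(w * 1) -[RHS]/(- w^-1 * (- sin (w * t) * (w * 1))); field.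
  + by rewrite /= -[w *: 0]/(w * 0) -[w *: 1]/(w * 1) mulr0 mulr1 cosw cos0.
  + exact: (mode_measurable k).2.
Qed.

Lemma mode_orthogonal j k : j != k -> inner (mode j) (mode k) = 0.
Proof.
move=> jk; rewrite (@inner_ae _ _ _ (e_ j) (e_ k)) ?mode_cLfun2//; try exact/L2_fun_to/mode_cLfun2.
have kj : j - k != 0 by rewrite subr_eq0.
rewrite (_ : (fun t => e_ j t * (e_ k t)^*) = e_ (j - k)); last first.
  by apply/funext => t; rewrite modeB.
by have [] := cos_sin_integral0 kj; rewrite /cintegral /= => -> ->.
Qed.
End Fourier.

(** * Polynomials approximating a step on the unit interval *)

Section Bernoulli.
Context (R : realType).
Implicit Types (a u : R).

Lemma bernoulli_subr a n : 0 <= a <= 1 -> 1 - n%:R * a <= (1 - a) ^+ n.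
Proof.
move=> /andP[a0 a1]; elim: n => [|n IH]; first by rewrite mul0r subr0 expr0.
have a1' : 0 <= 1 - a by lra.
rewrite exprS (le_trans _ (ler_wpM2l a1' IH))// -natr1.
have : 0 <= n%:R * a * a by rewrite !mulr_ge0.
by lra.
Qed.

Lemma bernoulli_addr a n : 0 <= a -> 1 + n%:R * a <= (1 + a) ^+ n.
Proof.
move=> a0; elim: n => [|n IH]; first by rewrite mul0r addr0 expr0.
have a1' : 0 <= 1 + a by lra.
rewrite exprS (le_trans _ (ler_wpM2l a1' IH))// -natr1.
have : 0 <= n%:R * a * a by rewrite !mulr_ge0.
by lra.
Qed.

(* Polynomials in [u] converging on [0, 1] to the indicator of [0, 1/2[, except
   at 1/2. *)
Definition step_poly (n : nat) u : R := (1 - u ^+ n) ^+ (2 ^ n).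

Lemma step_poly_ge0 n u : 0 <= u <= 1 -> 0 <= step_poly n u <= 1.
Proof.
move=> /andP[u0 u1]; have h : 0 <= u ^+ n <= 1 by rewrite exprn_ge0// exprn_ile1.
by rewrite /step_poly exprn_ge0 ?exprn_ile1//; lra.
Qed.

(** Bernoulli's inequality bounds the value below by 1 - 2^n u^n. *)
Lemma step_poly_cvg1 u : 0 <= u < 2^-1 -> step_poly ^~ u @ \oo --> (1 : R).
Proof.
move=> /andP[u0 u2].
have h n : 1 - (2 * u) ^+ n <= step_poly n u <= 1.
  have u01 : 0 <= u <= 1 by lra.
  have /andP[_ ->] := step_poly_ge0 n u01; rewrite andbT.
  rewrite exprMn -natrX; apply: bernoulli_subr.
  by rewrite exprn_ge0// exprn_ile1//; lra.
apply: (@squeeze_cvgr _ _ _ _ (fun n => 1 - (2 * u) ^+ n) (cst 1)).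
- by apply: nearW => n; exact: h.
- rewrite -[X in _ --> X]subr0; apply: cvgB; first exact: cvg_cst.
  by apply: cvg_expr; rewrite ger0_norm; lra.
- exact: cvg_cst.
Qed.

(** Multiplying by (1 + u^n)^(2^n) gives at most 1, and Bernoulli's inequality bounds that factor
    below by (2u)^n. *)
Lemma step_poly_cvg0 u : 2^-1 < u <= 1 -> step_poly ^~ u @ \oo --> (0 : R).
Proof.
move=> /andP[u2 u1].
have u01 : 0 <= u <= 1 by lra.
have h n : 0 <= step_poly n u <= ((2 * u)^-1) ^+ n.
  have /andP[p0 _] := step_poly_ge0 n u01; rewrite p0/=.
  have un : 0 <= u ^+ n <= 1 by rewrite exprn_ge0 ?exprn_ile1//; lra.
  have p2 : 0 < (2 * u) ^+ n by rewrite exprn_gt0//; lra.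
  rewrite exprVn -div1r ler_pdivlMr//.
  have /andP[un0 un1] := un.
  have : step_poly n u * (1 + u ^+ n) ^+ (2 ^ n) <= 1.
    rewrite -exprMn exprn_ile1//; first nra.
    by have := sqr_ge0 (u ^+ n); nra.
  apply: le_trans; rewrite ler_wpM2l//.
  have := bernoulli_addr (2 ^ n) un0; rewrite natrX -exprMn.
  by lra.
apply: (@squeeze_cvgr _ _ _ _ (cst 0) (fun n => ((2 * u)^-1) ^+ n)).
- by apply: nearW => n; exact: h.
- exact: cvg_cst.
- apply: cvg_expr; rewrite ger0_norm ?invr_ge0; last by lra.
  by rewrite invf_lt1; lra.
Qed.
End Bernoulli.

(** * Trigonometric polynomials against a function with zero Fourier coefficients *)

Section Totality.
Context (R : realType).
Local Notation m := (@circle_measure R).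
Local Notation aef := (ae_filter_ringOfSetsType m).
Local Notation L2 := (L2 R).
Local Notation mu := (@lebesgue_measure R).
Local Notation e_ := (@fourier_mode R).

Section Annihilator.
Context (F : R -> R[i]) (F2 : F \in @cLfun2 R).
Hypothesis F0 : forall k, fourier_coef F k = 0.

(** Asking this for all frequencies makes the class stable under multiplication by modes, hence by
    trigonometric polynomials. *)
Definition annihilates (g : R -> R[i]) := forall k,
  cintegrable (fun t => F t * g t * (e_ k t)^*) /\
  cintegral (fun t => F t * g t * (e_ k t)^*) = 0.

Lemma annihilates1 : annihilates (fun=> 1).
Proof.
move=> k; under eq_fun do rewrite mulr1; split; last exact: F0.
by apply: cLfun2_mul_integrable => //; exact: mode_cLfun2.
Qed.

Lemma annihilatesD g h : annihilates g -> annihilates h ->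
  annihilates (fun t => g t + h t).
Proof.
move=> gA hA k; have [gi g0] := gA k; have [hi h0] := hA k.
under eq_fun do rewrite mulrDr mulrDl.
split; first exact: cintegrableD.
by rewrite cintegralD// g0 h0 addr0.
Qed.

Lemma annihilatesZ c g : annihilates g -> annihilates (fun t => c * g t).
Proof.
move=> gA k; have [gi g0] := gA k.
under eq_fun do rewrite mulrCA -mulrA.
split; first exact: cintegrableZ.
by rewrite cintegralZ// g0 mulr0.
Qed.

Lemma annihilates_mode j g : annihilates g -> annihilates (fun t => e_ j t * g t).
Proof.
move=> gA k; have := gA (k - j).
rewrite (_ : (fun t => F t * g t * (e_ (k - j) t)^*) =
  (fun t => F t * (e_ j t * g t) * (e_ k t)^*))//.
apply/funext => t.
transitivity (F t * g t * e_ (j - k) t).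
  by congr (_ * _); rewrite -[j - k]opprB modeN.
by rewrite modeB; ring.
Qed.

Lemma annihilates_trig (a : R) (c : R[i]) g (h : R -> R[i]) :
  (forall t, h t = a%:C + c * e_ 1 t + c^* * e_ (-1) t) ->
  annihilates g -> annihilates (fun t => h t * g t).
Proof.
move=> hE gA; under eq_fun do rewrite hE !mulrDl -!mulrA.
apply: annihilatesD; first apply: annihilatesD.
- exact: annihilatesZ.
- by apply: annihilatesZ; exact: annihilates_mode.
- by apply: annihilatesZ; exact: annihilates_mode.
Qed.

(** Each sine has half a frequency, but their product is a trigonometric polynomial of degree one.
    On ]0, 1[ the first sine is positive and the second changes sign at x, so the value crosses 1/2
    exactly there, and [step_poly] of it tends to the indicator of [0, x]. *)
Definition sine_bump (x t : R) : R := 2^-1 + 2^-1 * (sin (pi * t) * sin (pi * (t - x))).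

Lemma sine_bumpE x t : sine_bump x t = 2^-1 + cos (pi * x) / 4 -
  (cos (pi * x) * cos (2 * pi * t) + sin (pi * x) * sin (2 * pi * t)) / 4.
Proof.
rewrite /sine_bump mulrBr sinB.
have -> : 2 * pi * t = pi * t + pi * t by ring.
rewrite (cosD (pi * t) (pi * t)) (sinD (pi * t) (pi * t)).
have := cos2Dsin2 (pi * t); rewrite !expr2.
move: (cos _) (sin _) (cos (pi * x)) (sin (pi * x)) => c s c' s' cs.
transitivity (2^-1 + c' * (c * c + s * s) / 4 - (c' * (c * c - s * s) + s' * (s * c + c * s)) / 4).
  by field.
by rewrite cs mulr1.
Qed.

Lemma sine_bump_trig x : exists (a : R) (c : R[i]), forall t,
  (sine_bump x t)%:C = a%:C + c * e_ 1 t + c^* * e_ (-1) t.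
Proof.
exists (2^-1 + cos (pi * x) / 4), ((- cos (pi * x) / 8) +i* (sin (pi * x) / 8)) => t.
have e1 : e_ 1 t = cos (2 * pi * t) +i* sin (2 * pi * t).
  by rewrite /fourier_mode mulr1.
rewrite sine_bumpE modeN e1; simpc.
by congr (_ +i* _); field.
Qed.

Lemma sine_bump01 x t : 0 <= sine_bump x t <= 1.
Proof.
have H (a b : R) : -1 <= a <= 1 -> -1 <= b <= 1 -> -1 <= a * b <= 1.
  by move=> ? ?; apply/andP; split; nra.
have Hs (y : R) : -1 <= sin y <= 1 by rewrite sin_geN1 sin_le1.
have := H _ _ (Hs (pi * t)) (Hs (pi * (t - x))); rewrite /sine_bump.
by move: (_ * _) => z; lra.
Qed.

Lemma annihilates_step x n : annihilates (fun t => (step_poly n (sine_bump x t))%:C).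
Proof.
have [a [c hE]] := sine_bump_trig x.
have Hpow j g : annihilates g -> annihilates (fun t => ((sine_bump x t) ^+ j)%:C * g t).
  move=> gA; elim: j => [|j IH]; first by under eq_fun do rewrite expr0 mul1r.
  under eq_fun do rewrite exprS rmorphM /= -mulrA.
  exact: (annihilates_trig hE).
rewrite /step_poly; elim: (2 ^ n)%N => [|N IH].
  by under eq_fun do rewrite expr0; exact: annihilates1.
under eq_fun do rewrite exprS rmorphM rmorphB /= mulrBl mul1r -mulN1r.
by apply: annihilatesD => //; apply: annihilatesZ; exact: Hpow.
Qed.
End Annihilator.
End Totality.

(** * Totality of the Fourier modes *)

Section StepTotality.
Context (R : realType).
Local Notation m := (@circle_measure R).
Local Notation aef := (ae_filter_ringOfSetsType m).
Local Notation mu := (@lebesgue_measure R).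
Local Notation e_ := (@fourier_mode R).

Lemma circle_ae_neq (x : R) : {ae m, forall t, t != x}.
Proof.
exists [set x]; split => //; last by move=> t /= /negP; rewrite negbK => /eqP.
rewrite /circle_measure /= /mrestr; apply: (@subset_measure0 _ _ _ mu _ [set x]) => //.
- by apply: measurableI => //; exact: measurable_itv.
- exact: lebesgue_measure_set1.
Qed.

Lemma circle_ae_itv : {ae m, forall t, 0 <= t < 1}.
Proof.
exists (~` `[0, 1[); split; first by apply: measurableC; exact: measurable_itv.
  by rewrite /circle_measure /= /mrestr setICl measure0.
by move=> t /=; rewrite in_itv.
Qed.

Lemma circle_ae (P : R -> Prop) : {ae mu, forall t, P t} -> {ae m, forall t, P t}.
Proof.
move=> [N [mN N0 PN]]; exists N; split => //.
rewrite /circle_measure /= /mrestr; apply: (@subset_measure0 _ _ _ mu _ N) => //.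
by apply: measurableI => //; exact: measurable_itv.
Qed.

Lemma sine_bump_lt (x t : R) : 0 < x < 1 -> 0 < t < 1 -> t != x ->
  if t < x then sine_bump x t < 2^-1 else 2^-1 < sine_bump x t.
Proof.
move=> /andP[x0 x1] /andP[t0 t1] tx.
have pi0 := pi_gt0 R.
have st : 0 < sin (pi * t) by apply: sin_gt0_pi; rewrite ?in_itv/=; nra.
case: ltP => tlex; rewrite /sine_bump.
  have : 0 < sin (pi * (x - t)) by apply: sin_gt0_pi; rewrite ?in_itv/=; nra.
  rewrite -opprB mulrN sinN; nra.
have xt : x < t by rewrite lt_def tx.
have : 0 < sin (pi * (t - x)) by apply: sin_gt0_pi; rewrite ?in_itv/=; nra.
by nra.
Qed.

Lemma sine_bump_measurable (x : R) : measurable_fun setT (sine_bump x).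
Proof.
apply: measurable_funD => //; apply: measurable_funM => //; apply: measurable_funM.
  apply: (measurableT_comp (continuous_measurable_fun (@continuous_sin R))).
  exact: measurable_funM.
apply: (measurableT_comp (continuous_measurable_fun (@continuous_sin R))).
by apply: measurable_funM => //; exact: measurable_funB.
Qed.

Lemma step_poly_measurable (x : R) n : measurable_fun setT (fun t => step_poly n (sine_bump x t)).
Proof.
apply: measurable_funX; apply: measurable_funB => //; apply: measurable_funX.
exact: sine_bump_measurable.
Qed.

(** Dominated convergence turns the hypothesis into a vanishing integral of f over [0, x] for every
    x in ]0, 1[; Lebesgue differentiation then gives f = 0 almost everywhere. *)
Lemma step_total (f : R -> R) : m.-integrable setT (EFin \o f) ->
  (forall x n, \int[m]_t (f t * step_poly n (sine_bump x t)) = 0) ->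
  {ae m, forall t, f t = 0}.
Proof.
move=> fi f0.
have mf : measurable_fun setT f by apply/measurable_EFinP; exact: (measurable_int m).
have mI (a b : itv_bound R) : measurable ([set` Interval a b] : set (measurableTypeR R)).
  exact: measurable_itv.
have h1 x : 0 < x < 1 -> (\int[m]_t ((EFin \o f) \_ `[0%R, x]) t = 0)%E.
  move=> x01; have /andP[x0 x1] := x01.
  pose fn n t := (f t * step_poly n (sine_bump x t))%:E.
  have mfn n : measurable_fun setT (fn n).
    by apply/measurable_EFinP; apply: measurable_funM => //; exact: step_poly_measurable.
  have mlim : measurable_fun setT ((EFin \o f) \_ `[0, x]).
    apply: (measurable_restrictT _ _).1 => //.
    by apply/measurable_EFinP; exact: measurable_funS mf.
  have fn_le n t : `|f t * step_poly n (sine_bump x t)| <= `|f t|.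
    have /andP[p0 p1] := step_poly_ge0 n (sine_bump01 x t).
    by rewrite normrM (ger0_norm p0) ler_piMr.
  have [|||_ _ lim] := @dominated_convergence _ _ _ m setT measurableT fn
      ((EFin \o f) \_ `[0, x]) (fun t => `|(EFin \o f) t|%E) mfn mlim _ _ _.
  (* At 0 and x the bump equals 1/2, where the step polynomials do not tend to the indicator. *)
  - have := circle_ae_neq x; have := circle_ae_neq 0; have := circle_ae_itv.
    apply: (@filterS3 _ _ aef) => t t01 t0 tx _.
    have {t0}t01 : 0 < t < 1 by move: t01; rewrite [0 < t]lt_def t0.
    have /andP[b0 b1] := sine_bump01 x t.
    rewrite patchE; case: ifPn => tin.
      have tltx : t < x.
        by move: tin; rewrite inE /= in_itv /= => /andP[_]; rewrite le_eqVlt (negbTE tx).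
      have := sine_bump_lt x01 t01 tx; rewrite tltx => b2.
      apply: cvg_EFin; first exact: nearW.
      rewrite -[X in _ --> X]mulr1; apply: cvgM; first exact: cvg_cst.
      by apply: step_poly_cvg1; rewrite b0.
    have tgex : (t < x) = false.
      apply: contraNF tin => tx'; rewrite inE /= in_itv /= (ltW tx').
      by have /andP[/ltW -> _] := t01.
    have := sine_bump_lt x01 t01 tx; rewrite tgex => b2.
    apply: cvg_EFin; first exact: nearW.
    rewrite -[X in _ --> X](mulr0 (f t)); apply: cvgM; first exact: cvg_cst.
    by apply: step_poly_cvg0; rewrite b2.
  - exact: integrable_abse.
  - by apply: (@nearW _ _ _ aef) => t n _; rewrite /fn /= lee_fin.
  apply/esym/(cvg_unique _ _ lim) => //.
  rewrite (_ : [sequence _]_n = cst 0%E); first exact: cvg_cst.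
  apply/funext => n /=.
  rewrite -[LHS]fineK; first by rewrite -[fine _]/(Rintegral m setT _) f0.
  apply/integrable_fin_num => //.
  by apply: (@le_integrable _ _ _ m setT measurableT _ _ (mfn n) _ fi) => t _; rewrite /= lee_fin.
have fi01 : mu.-integrable `[0, 1[ (EFin \o f).
  apply/integrableP; split.
    by apply/measurable_EFinP; exact: measurable_funS mf.
  move/integrableP : fi => [_]; rewrite circle_integral//.
  by apply: measurableT_comp => //; exact/measurable_EFinP.
(* Cut off so as to be integrable on the whole line, where the differentiation theorem is
   applied. *)
pose f1 := f \_ `[0, 1[.
have f1i : mu.-integrable setT (EFin \o f1).
  have := (@integrable_mkcond _ _ _ mu _ (EFin \o f) (mI (BLeft 0) (BLeft 1))).1 fi01.
  by rewrite restrict_EFin.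
have h2 x : 0 < x < 1 -> \int[mu]_(t in `[0, x]) f1 t = 0.
  move=> /[dup] x01 /h1; rewrite circle_integral; last first.
    apply: (measurable_restrictT _ _).1 => //.
    by apply/measurable_EFinP; exact: measurable_funS mf.
  rewrite -integral_mkcondr setIC integral_mkcondr /Rintegral => h.
  by rewrite -[RHS]/(fine 0%E) -[in RHS]h restrict_EFin.
have : {ae m, forall t, lebesgue_pt f1 t}.
  apply: circle_ae; apply: lebesgue_differentiation.
  exact: integrable_locally.
have := circle_ae_neq 0; have := circle_ae_itv.
apply: (@filterS3 _ _ aef) => t t01 t0 tl.
have {t0}/andP[t0 t1] : 0 < t < 1 by move: t01; rewrite [0 < t]lt_def t0.
have fi1 : mu.-integrable `[0, 1] (EFin \o f1) by exact: integrableS f1i.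
have a0 : (0%R%:E < (t : R)%:E)%E by rewrite lte_fin.
have [_] := @FTC1_lebesgue_pt R f1 (BLeft 0) t 1 t1 fi1 a0 tl.
rewrite derive1E (@near_eq_derive _ _ _ _ (cst 0)).
  by rewrite derive_cst /f1 patchE mem_set//= in_itv/=.
near=> y; apply: h2; apply/andP; split.
  by near: y; exact: lt_nbhsr.
by near: y; exact: lt_nbhsl.
Unshelve. all: by end_near. Qed.

(** The step polynomials are real valued, so at frequency 0 the annihilation splits into one
    statement for the real part of F and one for the imaginary part. *)
Lemma fourier_total (F : R -> R[i]) : F \in @cLfun2 R ->
  (forall k, fourier_coef F k = 0) -> {ae m, forall t, F t = 0}.
Proof.
move=> F2 F0.
have key x n := annihilates_step F2 F0 x n 0.
have [i1 i2] : cintegrable F.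
  have [+ _] := annihilates1 F2 F0 0.
  rewrite (_ : (fun t => F t * 1 * (e_ 0 t)^*) = F)//.
  apply/funext => t; rewrite mode0 mulr1; case: (F t) => a b; simpc.
  by congr (_ +i* _); ring.
have reE (z : R[i]) (c : R) : complex.Re (z * c%:C * (1 : R[i])^*) = complex.Re z * c.
  by case: z => a b /=; ring.
have imE (z : R[i]) (c : R) : complex.Im (z * c%:C * (1 : R[i])^*) = complex.Im z * c.
  by case: z => a b /=; ring.
have r0 : {ae m, forall t, complex.Re (F t) = 0}.
  apply: step_total i1 _ => x n; have [_ [h _]] := key x n.
  by rewrite -[RHS]h; apply: eq_Rintegral => t _; rewrite mode0 reE.
have j0 : {ae m, forall t, complex.Im (F t) = 0}.
  apply: step_total i2 _ => x n; have [_ [_ h]] := key x n.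
  by rewrite -[RHS]h; apply: eq_Rintegral => t _; rewrite mode0 imE.
by apply: (@filterS2 _ _ aef _ _ _ _ r0 j0) => t; case: (F t) => a b /= -> ->.
Qed.
End StepTotality.

(** * The Hardy space *)

Section HardySpace.
Context (R : realType).
Local Notation m := (@circle_measure R).
Local Notation aef := (ae_filter_ringOfSetsType m).
Local Notation L2 := (L2 R).
Local Notation e_ := (@fourier_mode R).
Implicit Types (f g h : L2).

Lemma inner_limit (u : nat -> L2) l g : converges (@re_inner R) u l ->
  (forall n, inner (u n) g = 0) -> inner l g = 0.
Proof.
move=> ul u0; have L0 y : (forall n, re_inner (u n) y = 0) -> re_inner l y = 0.
  move=> h; apply: (cvg_unique _ (converges_rip (@L2_hilbert R) (y := y) ul)) => //.
  by apply: cvg_near_cst; exact: nearW.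
rewrite inner_re !L0// => n; rewrite /re_inner ?u0//.
by rewrite innerZr u0 mulr0.
Qed.

Lemma inner_eq0P (D : set L2) f : (forall (a : R[i]) g, D g -> D (a *: g)) ->
  (forall g, D g -> re_inner f g = 0) -> forall g, D g -> inner f g = 0.
Proof. by move=> DZ D0 g Dg; rewrite inner_re !D0//; exact: DZ. Qed.

(** Riesz representation of h |-> Re <h, f> on D, with the identity as operator; closedness keeps
    the representing vector in D. *)
Lemma orthogonal_projection (D : set L2) : D 0 ->
  (forall (a : R[i]) f g, D f -> D g -> D (a *: f + g)) ->
  (forall u l, (forall n, D (u n)) -> converges (@re_inner R) u l -> D l) ->
  forall f, exists p, D p /\ forall g, D g -> inner (f - p) g = 0.
Proof.
move=> D0 DD Dcl f.
pose A : {linear L2 -> L2} := idfun.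
have [//|a x y|h _|p [u [Du up pE]]] := @riesz _ _ _ (@L2_hilbert R) _ D A
    (fun h => re_inner h f) (Num.sqrt (re_inner f f)) D0 _ _ _.
- by rewrite (ripDl (@L2_hilbert R)) (ripZl (@L2_hilbert R)).
- by rewrite mulrC; exact: (rip_cauchy_schwarz (@L2_hilbert R)).
exists p; split; first exact: Dcl up.
apply: inner_eq0P => [a g Dg|g Dg]; first by rewrite -[_ *: _]addr0; exact: DD.
rewrite (ripBl (@L2_hilbert R)) (hilbertC (@L2_hilbert R)).
by rewrite (hilbertC (@L2_hilbert R) p) -[re_inner g p]/(re_inner (A g) p) pE// subrr.
Qed.

Lemma H2P f : H2 R f <-> forall k : int, k < 0 -> inner f (mode R k) = 0.
Proof. by split=> fH k k0; have := fH k k0; rewrite inner_mode. Qed.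

Lemma H2_0 : H2 R 0.
Proof. by apply/H2P => k _; rewrite -[0](scale0r 0) innerZl mul0r. Qed.

Lemma H2_linear (a : R[i]) f g : H2 R f -> H2 R g -> H2 R (a *: f + g).
Proof.
move=> /H2P fH /H2P gH; apply/H2P => k k0.
by rewrite innerDl innerZl fH// gH// mulr0 addr0.
Qed.

Lemma H2_closed u l : (forall n, H2 R (u n)) -> converges (@re_inner R) u l -> H2 R l.
Proof.
by move=> uH ul; apply/H2P => k k0; apply: (inner_limit ul) => n; have /H2P/(_ k k0) := uH n.
Qed.

Lemma mult_ae (C : R) (F : R -> R[i]) f : cmeasurable F ->
  {ae m, forall t, sqmod (F t) <= C} ->
  {ae m, forall t, L2_fun (mult F f) t = F t * L2_fun f t}.
Proof.
by move=> mF FC; apply/L2_fun_to/(mul_cLfun2 mF FC)/L2_fun_cLfun2.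
Qed.

Lemma mult_adjoint (C : R) (F : R -> R[i]) f g : cmeasurable F ->
  {ae m, forall t, sqmod (F t) <= C} ->
  inner (mult F f) g = inner f (mult (fun t => (F t)^*) g).
Proof.
move=> mF FC; have mF' := cmeasurable_conj mF.
have FC' : {ae m, forall t, sqmod (F t)^* <= C}.
  by apply: (@filterS _ _ aef _ _ _ FC) => t; case: (F t) => a b; rewrite /sqmod /= sqrrN.
have f2 := L2_fun_cLfun2 f; have g2 := L2_fun_cLfun2 g.
rewrite (inner_ae (mul_cLfun2 mF FC f2) g2 (mult_ae f mF FC)); last exact: (@nearW _ _ _ aef).
rewrite (inner_ae f2 (mul_cLfun2 mF' FC' g2) _ (mult_ae g mF' FC')); last exact: (@nearW _ _ _ aef).
congr cintegral; apply/funext => t.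
by case: (F t) (L2_fun f t) (L2_fun g t) => [a b] [c d] [x y]; simpc; congr (_ +i* _); ring.
Qed.

Lemma total_modes f : (forall k, inner f (mode R k) = 0) -> f = 0.
Proof.
move=> f0; have h := fourier_total (L2_fun_cLfun2 f)
  (fun k => etrans (esym (inner_mode f k)) (f0 k)).
have L20 := L2_funZ 0 f; rewrite scale0r in L20.
by apply: L2_eq; apply: (@filterS2 _ _ aef _ _ _ _ h L20) => t -> ->; rewrite mul0r.
Qed.

(* [H2] is the orthogonal complement of the functions [w] with w^(j) = 0 for
   j >= 0, since those are limits of the modes of negative frequency. *)
Lemma H2_orthogonal f w : H2 R f -> (forall j : int, 0 <= j -> inner w (mode R j) = 0) ->
  inner f w = 0.
Proof.
move=> /H2P fH wT; pose T := [set y : L2 | forall j : int, 0 <= j -> inner y (mode R j) = 0].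
have [||u l uT ul|p [pT pE]] := @orthogonal_projection T _ _ _ f.
- by move=> j _; rewrite -[0](scale0r 0) innerZl mul0r.
- by move=> a g h gT hT j j0; rewrite innerDl innerZl gT// hT// mulr0 addr0.
- by move=> j j0; apply: (inner_limit ul) => n; exact: uT.
(* The projection p of f onto T has no coefficient of frequency j >= 0, being in T, and none of
   frequency j < 0, since those modes lie in T and are orthogonal to f. *)
suff p0 : p = 0 by have := pE w wT; rewrite p0 subr0.
apply: total_modes => j; have [j0|j0] := leP 0 j; first exact: pT.
have mT : T (mode R j).
  by move=> i i0; apply: mode_orthogonal; apply: contraTneq i0 => <-; rewrite -ltNge.
have := pE _ mT; rewrite -scaleN1r innerDl innerZl fH// add0r mulN1r => /eqP.
by rewrite oppr_eq0 => /eqP.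
Qed.

(** <F f, e_k> = <f, conj(F) e_k>, and for j >= 0 > k the coefficient of conj(F) e_k at j is the
    conjugate of that of F at k - j < 0. *)
Lemma H2_mult (C : R) (F : R -> R[i]) f : cmeasurable F ->
  {ae m, forall t, sqmod (F t) <= C} ->
  (forall k : int, k < 0 -> fourier_coef F k = 0) ->
  H2 R f -> H2 R (mult F f).
Proof.
move=> mF FC F0 fH; apply/H2P => k k0; rewrite (mult_adjoint _ _ mF FC).
apply: H2_orthogonal => // j j0.
have mF' := cmeasurable_conj mF.
have FC' : {ae m, forall t, sqmod (F t)^* <= C}.
  by apply: (@filterS _ _ aef _ _ _ FC) => t; case: (F t) => a b; rewrite /sqmod /= sqrrN.
have Fi : cintegrable (fun t => F t * (e_ (k - j) t)^*).
  apply: cLfun2_mul_integrable; last exact: mode_cLfun2.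
  have := mul_cLfun2 mF FC (cst_cLfun2 1).
  by under eq_fun do rewrite mulr1.
have k2 := mode_cLfun2 R k; have j2 := mode_cLfun2 R j.
rewrite (@inner_ae _ _ _ (fun t => (F t)^* * e_ k t) (e_ j))//; first last.
- exact: L2_fun_to.
- have h1 := mult_ae (mode R k) mF' FC'; have h2 := L2_fun_to k2.
  by apply: (@filterS2 _ _ aef _ _ _ _ h1 h2) => t -> ->.
- exact: mul_cLfun2 FC' k2.
have kj : k - j < 0 by rewrite subr_lt0 (lt_le_trans k0).
rewrite (_ : (fun t => (F t)^* * e_ k t * (e_ j t)^*) =
  (fun t => (F t * (e_ (k - j) t)^*)^*)).
  by rewrite cintegral_conj// -[cintegral _]/(fourier_coef F (k - j)) F0// conjc0.
apply/funext => t; rewrite modeB.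
by case: (F t) (e_ k t) (e_ j t) => [a b] [c d] [x y]; simpc; congr (_ +i* _); ring.
Qed.
End HardySpace.

(** * The Hardy space as a Hilbert space *)

Section HardyHilbert.
Context (R : realType).
Local Notation L2 := (L2 R).

Definition H2_pred : {pred L2} := fun f => `[< H2 R f >].

Lemma H2_pred_submod_closed : submod_closed H2_pred.
Proof.
split; first exact/asboolP/H2_0.
by move=> a f g /asboolP fH /asboolP gH; exact/asboolP/H2_linear.
Qed.

HB.instance Definition _ :=
  GRing.isSubmodClosed.Build R[i] L2 H2_pred H2_pred_submod_closed.

(** A type of its own, because the abstract operator results concern linear maps defined on a whole
    space. *)
Record hardy := Hardy { hardy_val :> L2; _ : hardy_val \in H2_pred }.

HB.instance Definition _ := [isSub for hardy_val].
HB.instance Definition _ := [Choice of hardy by <:].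
HB.instance Definition _ := [SubChoice_isSubLmodule of hardy by <:].

Lemma hardyP (f : hardy) : H2 R f.
Proof. by case: f => f /= /asboolP. Qed.

Definition to_hardy (f : L2) (fH : H2 R f) : hardy := Hardy (asboolT fH).

Definition hardy_inner (f g : hardy) : R := re_inner f g.

Lemma hardy_hilbert : hilbert hardy_inner.
Proof.
have hL := @L2_hilbert R.
split; rewrite /hardy_inner.
- by move=> f g h; exact: (hilbertDl hL).
- by move=> a f g; exact: (hilbertZl hL).
- by move=> f g; exact: (hilbertJ hL).
- by move=> f g; exact: (hilbertC hL).
- by move=> f; exact: (hilbert_ge0 hL).
- by move=> f f0; apply/val_inj; exact: (hilbert_eq0 hL).
- move=> u uC; have [l ul] := @hilbert_complete _ _ _ hL (fun n => hardy_val (u n)) uC.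
  by exists (to_hardy (H2_closed (fun n => hardyP (u n)) ul)).
Qed.
End HardyHilbert.

(** * Multiplication operators *)

Local Notation "h /\ae k" := (@filterI _ _ (ae_filter_ringOfSetsType _) _ _ h k)
  (at level 80, right associativity).

Section Multipliers.
Context (R : realType).
Local Notation m := (@circle_measure R).
Local Notation aef := (ae_filter_ringOfSetsType m).
Local Notation L2 := (L2 R).
Local Notation hardy := (hardy R).

(** Agreement with g makes the product square integrable, so [mult] does not take its default
    value. *)
Lemma mult_eq (F : R -> R[i]) (f g : L2) : cmeasurable F ->
  {ae m, forall t, L2_fun g t = F t * L2_fun f t} -> mult F f = g.
Proof.
move=> mF gF.
have Ff2 : (fun t => F t * L2_fun f t) \in @cLfun2 R.
  apply: (@le_cLfun2 R 1 _ (L2_fun g)); last first.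
  - by apply: (@filterS _ _ aef _ _ _ gF) => t ->; rewrite mul1r.
  - exact: L2_fun_cLfun2.
  - by apply: cmeasurableM => //; exact/cLfun2_measurable/L2_fun_cLfun2.
apply: L2_eq; have h := L2_fun_to Ff2.
by apply: (@filterS2 _ _ aef _ _ _ _ h gF) => t; rewrite /mult -/(to_L2 _) => -> ->.
Qed.

Lemma hardy_projection (f : L2) : exists p : hardy, forall g : hardy, inner (f - hardy_val p) g = 0.
Proof.
have [|||p [pH pE]] := @orthogonal_projection R (H2 R) _ _ _ f.
- exact: H2_0.
- exact: H2_linear.
- exact: H2_closed.
- by exists (to_hardy pH) => g; exact/pE/hardyP.
Qed.

Definition hardy_proj (f : L2) : hardy := projT1 (cid (hardy_projection f)).

Lemma hardy_projP f (g : hardy) : inner f g = inner (hardy_proj f) g.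
Proof.
have := projT2 (cid (hardy_projection f)) g; rewrite -/(hardy_proj f).
by rewrite -scaleN1r innerDl innerZl mulN1r => /eqP; rewrite subr_eq0 => /eqP.
Qed.

(** Two projections of f differ by an element of [H2] orthogonal to itself, so the choice made by
    [xget] is this one. *)
Lemma orth_proj_hardy f : orth_proj (H2 R) f = hardy_proj f.
Proof.
have hL := @L2_hilbert R.
rewrite /orth_proj; set P := [set g | _].
have Pp : P (hardy_proj f).
  split; first exact: hardyP.
  by move=> h hH; exact: (projT2 (cid (hardy_projection f)) (to_hardy hH)).
have [xH xE] := xgetPex 0 (ex_intro _ _ Pp).
set x := xget 0 P in xH xE *; have [_ pE] := Pp.
apply/eqP; rewrite -subr_eq0; apply/eqP/(hilbert_eq0 hL).
have dH : H2 R (x - hardy_val (hardy_proj f)).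
  by rewrite addrC -scaleN1r; apply: H2_linear => //; exact: hardyP.
have dE : x - hardy_val (hardy_proj f) = (f - hardy_val (hardy_proj f)) - (f - x).
  by rewrite opprB [RHS]addrC subrKA.
by rewrite /re_inner {1}dE addrC -scaleN1r innerDl innerZl xE// pE// mulr0 addr0.
Qed.

Lemma hardy_valD (f g : hardy) : hardy_val (f + g) = hardy_val f + hardy_val g.
Proof. by []. Qed.

Lemma hardy_valZ (a : R[i]) (f : hardy) : hardy_val (a *: f) = a *: hardy_val f.
Proof. by []. Qed.

Lemma hardy_scale_adj (a : R[i]) (f g : hardy) :
  hardy_inner (a *: f) g = hardy_inner f (a^* *: g).
Proof.
rewrite /hardy_inner /re_inner -[hardy_val (a *: f)]/(a *: hardy_val f).
rewrite -[hardy_val (_ *: g)]/(a^* *: hardy_val g) innerZl innerZr.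
by case: a => a b; rewrite /= opprK.
Qed.

Lemma adjoint_linear (V : {linear hardy -> hardy}) (W : hardy -> hardy) :
  (forall f g, hardy_inner (V f) g = hardy_inner f (W g)) -> linear W.
Proof.
have hH := @hardy_hilbert R.
move=> VW a f g; apply: (rip_inj hH) => z.
rewrite (ripDl hH) hardy_scale_adj !(hilbertC hH _ z) [in RHS](hilbertC hH _ (_ *: z)).
rewrite -!VW (ripDr hH) linearZZ; congr (_ + _).
by rewrite (hilbertC hH) hardy_scale_adj (hilbertC hH).
Qed.
End Multipliers.

(** * Multiplication by an inner function and the associated Toeplitz operators *)

Section InnerFunction.
Context (R : realType) (I : R -> R[i]) (n : nat) (inner_I : inner_function I).
Local Notation m := (@circle_measure R).
Local Notation aef := (ae_filter_ringOfSetsType m).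
Local Notation L2 := (L2 R).
Local Notation hardy := (hardy R).
Local Notation r := (@hardy_inner R).
Let hH := @hardy_hilbert R.

Lemma inner_measurable : cmeasurable I.
Proof.
have [[/andP[I1 I2] _] _] := inner_I.
by split; [have := sub_Lfun_mfun I1|have := sub_Lfun_mfun I2]; rewrite inE.
Qed.

Lemma inner_sqmod : {ae m, forall t, sqmod (I t) = 1}.
Proof.
have [_ I1] := inner_I; apply: (@filterS _ _ aef _ _ _ I1) => t It.
apply: complexI; rewrite rmorphD !rmorphXn/=.
by have := add_Re2_Im2 (I t); rewrite It expr1n rmorphD !rmorphXn.
Qed.

Lemma inner_sqmod_le : {ae m, forall t, sqmod (I t) <= 1}.
Proof. by apply: (@filterS _ _ aef _ _ _ inner_sqmod) => t ->. Qed.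

Lemma inner_mult_H2 (f : hardy) : H2 R (mult I f).
Proof.
apply: (H2_mult inner_measurable inner_sqmod_le); last exact: hardyP.
by have [[_ +] _] := inner_I.
Qed.

Definition inner_shift_fun (f : hardy) : hardy := to_hardy (inner_mult_H2 f).

Lemma inner_shift_ae (f : hardy) :
  {ae m, forall t, L2_fun (inner_shift_fun f) t = I t * L2_fun f t}.
Proof. exact: mult_ae inner_measurable inner_sqmod_le. Qed.

Lemma inner_shift_linear : linear inner_shift_fun.
Proof.
move=> a f g; apply/val_inj; rewrite -[val (a *: _ + _)]/(hardy_val _) -[val _]/(mult I _).
rewrite !(hardy_valD, hardy_valZ); apply: mult_eq; first exact: inner_measurable.
have h1 := L2_funD (a *: hardy_val (inner_shift_fun f)) (hardy_val (inner_shift_fun g)).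
have h2 := L2_funZ a (hardy_val (inner_shift_fun f)).
have h3 := L2_funD (a *: hardy_val f) (hardy_val g).
have h4 := L2_funZ a (hardy_val f).
have h5 := inner_shift_ae f; have h6 := inner_shift_ae g.
apply: (@filterS _ _ aef _ _ _ (h1 /\ae h2 /\ae h3 /\ae h4 /\ae h5 /\ae h6)).
move=> t [e1 [e2 [e3 [e4 [e5 e6]]]]].
by rewrite e1 e2 e3 e4 e5 e6; ring.
Qed.

Definition inner_shift : {linear hardy -> hardy} := linear_pack inner_shift_linear.

Definition inner_coshift_fun (f : hardy) : hardy :=
  hardy_proj (mult (fun t => (I t)^*) f).

Lemma inner_shift_adj_fun f g : r (inner_shift f) g = r f (inner_coshift_fun g).
Proof.
rewrite /hardy_inner /re_inner
  [inner (inner_shift f) g](mult_adjoint f g inner_measurable inner_sqmod_le).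
by rewrite inner_conj hardy_projP -inner_conj.
Qed.

Definition inner_coshift : {linear hardy -> hardy} :=
  linear_pack (adjoint_linear inner_shift_adj_fun).

Lemma inner_shift_adj f g : r (inner_shift f) g = r f (inner_coshift g).
Proof. exact: inner_shift_adj_fun. Qed.

Lemma inner_shift_isometry f : inner_coshift (inner_shift f) = f.
Proof.
apply: (rip_inj hH) => z; rewrite (hilbertC hH) -inner_shift_adj (hilbertC hH).
congr complex.Re.
apply: ae_eq_cintegral.
- by apply/cintegrable_measurable/cLfun2_mul_integrable; exact: L2_fun_cLfun2.
- by apply/cintegrable_measurable/cLfun2_mul_integrable; exact: L2_fun_cLfun2.
have h1 := inner_shift_ae z; have h2 := inner_shift_ae f.
apply: (@filterS _ _ aef _ _ _ (h1 /\ae h2 /\ae inner_sqmod)) => t [e1 [e2 e3]].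
rewrite e1 e2; move: e3; case: (I t) (L2_fun f t) (L2_fun z t) => [a b] [c d] [x y].
rewrite /sqmod /= => ab; simpc; congr (_ +i* _).
  rewrite -[RHS]mul1r -ab; ring.
by rewrite -[RHS]mul1r -ab; ring.
Qed.

Lemma iter_shift_ae k (f : hardy) :
  {ae m, forall t, L2_fun (iter k inner_shift f) t = I t ^+ k * L2_fun f t}.
Proof.
elim: k => [|k IH]; first by apply: (@nearW _ _ _ aef) => t; rewrite mul1r.
have h := inner_shift_ae (iter k inner_shift f).
by apply: (@filterS2 _ _ aef _ _ _ _ h IH) => t -> ->; rewrite exprS mulrA.
Qed.

Lemma inner_exp_measurable k : cmeasurable (fun t => I t ^+ k).
Proof.
elim: k => [|k IH]; first exact: cmeasurable_cst.
by under eq_fun do rewrite exprS; apply: cmeasurableM => //; exact: inner_measurable.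
Qed.

Definition symbol (t : R) : R[i] := I t ^+ n * (1 + I t) / 2.

Lemma symbol_measurable : cmeasurable symbol.
Proof.
apply: cmeasurableM; last exact: cmeasurable_cst.
apply: cmeasurableM; first exact: inner_exp_measurable.
by apply: cmeasurableD; [exact: cmeasurable_cst|exact: inner_measurable].
Qed.

Lemma symbol_sqmod_le : {ae m, forall t, sqmod (symbol t) <= 1}.
Proof.
apply: (@filterS _ _ aef _ _ _ inner_sqmod) => t It.
have Ik k : sqmod (I t ^+ k) = 1.
  elim: k => [|k IH]; first by rewrite expr0 /sqmod /=; ring.
  by rewrite exprS sqmodM It IH mulr1.
rewrite /symbol -mulrA sqmodM Ik mul1r.
have -> : 2^-1 = (2^-1 : R)%:C by rewrite fmorphV/= rmorph_nat.
move: It; case: (I t) => a b; rewrite /sqmod /= => ab; nra.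
Qed.

Lemma symbol_mult (f : hardy) : mult symbol f = symbol_op inner_shift n f.
Proof.
apply: mult_eq; first exact: symbol_measurable.
pose g := f + inner_shift f.
have h1 := L2_funZ 2^-1 (hardy_val (iter n inner_shift g)).
have h2 := iter_shift_ae n g.
have h3 := L2_funD (hardy_val f) (hardy_val (inner_shift f)).
have h4 := inner_shift_ae f.
apply: (@filterS _ _ aef _ _ _ (h1 /\ae h2 /\ae h3 /\ae h4)) => t [e1 [e2 [e3 e4]]].
rewrite /symbol_op hardy_valZ e1 e2 hardy_valD e3 e4 /symbol; ring.
Qed.

Lemma symbol_toeplitz (f : hardy) :
  toeplitz symbol f = symbol_op inner_shift n f.
Proof.
rewrite /toeplitz orth_proj_hardy; congr hardy_val; apply: (rip_inj hH) => z.
by rewrite /hardy_inner /re_inner -hardy_projP symbol_mult.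
Qed.

(** Both sides are adjoint to multiplication by the symbol, which equals [symbol_op] on the Hardy
    space. *)
Lemma symbol_toeplitz_conj (f : hardy) :
  toeplitz (fun t => (symbol t)^*) f = symbol_adj inner_coshift n f.
Proof.
rewrite /toeplitz orth_proj_hardy; congr hardy_val; apply: (rip_inj hH) => z.
rewrite [RHS](hilbertC hH) -(symbol_op_adj hH n inner_shift_adj).
rewrite /hardy_inner /re_inner -hardy_projP inner_conj.
rewrite -(mult_adjoint _ _ symbol_measurable symbol_sqmod_le) symbol_mult.
by case: (inner _ _).
Qed.

Lemma kernel_mult (k : hardy) :
  mult (fun t => 2 * (\sum_(j < n) I t ^+ j) + I t ^+ n) k = kernel_op inner_shift n k.
Proof.
apply: mult_eq.
  apply: cmeasurableD; last exact: inner_exp_measurable.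
  apply: cmeasurableM; first exact: cmeasurable_cst.
  elim: (n) => [|j IH].
    by under eq_fun do rewrite big_ord0; exact: cmeasurable_cst.
  under eq_fun do rewrite big_ord_recr /=.
  by apply: cmeasurableD => //; exact: inner_exp_measurable.
elim: (n) => [|j IH].
  by apply: (@nearW _ _ _ aef) => t; rewrite big_ord0 mulr0 add0r mul1r.
have h1 := L2_funD (hardy_val (k + k)) (hardy_val (inner_shift (kernel_op inner_shift j k))).
have h2 := L2_funD (hardy_val k) (hardy_val k).
have h3 := inner_shift_ae (kernel_op inner_shift j k).
apply: (@filterS _ _ aef _ _ _ (h1 /\ae h2 /\ae h3 /\ae IH)) => t [e1 [e2 [e3 e4]]].
rewrite -[kernel_op _ _ k]/(k + k + inner_shift (kernel_op inner_shift j k)).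
rewrite hardy_valD e1 hardy_valD e2 e3 e4 big_ord_recl expr0 exprS.
rewrite [X in 1 + X](_ : _ = I t * \sum_(i < j) I t ^+ i); first by ring.
by rewrite big_distrr; apply: eq_bigr => i _; rewrite lift0 exprS.
Qed.

Lemma one_sub_mult (h : hardy) :
  mult (fun t => 1 - I t) h = hardy_val (h - inner_shift h).
Proof.
have mI := inner_measurable.
have mN : cmeasurable (fun t => - I t).
  by have := cmeasurableM (cmeasurable_cst (-1)) mI; under eq_fun do rewrite mulN1r.
apply: mult_eq; first by apply: cmeasurableD => //; exact: cmeasurable_cst.
have h1 := L2_funB (hardy_val h) (hardy_val (inner_shift h)).
have h2 := inner_shift_ae h.
apply: (@filterS _ _ aef _ _ _ (h1 /\ae h2)) => t [e1 e2].
by rewrite -[hardy_val _]/(hardy_val h - hardy_val (inner_shift h)) e1 e2; ring.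
Qed.

(** The orthogonal complement of the range of the shift is the kernel of its adjoint. *)
Lemma model_spaceP (k : hardy) : model_space I k <-> inner_coshift k = 0.
Proof.
split=> [[_ kI]|Wk0].
  apply: (rip_inj hH) => z; rewrite (rip0l hH) (hilbertC hH) -inner_shift_adj.
  rewrite (hilbertC hH) /hardy_inner /re_inner kI//.
  by exists z => //; exact: hardyP.
split; first exact: hardyP.
move=> _ [g gH <-].
have H (g' : hardy) : re_inner k (mult I g') = 0.
  by rewrite -[LHS]/(r k (inner_shift g')) (hilbertC hH) inner_shift_adj Wk0 (rip0r hH).
rewrite inner_re (H (to_hardy gH)).
have -> : 'i *: mult I g = hardy_val (inner_shift ('i *: to_hardy gH)) by rewrite linearZZ.
by rewrite [X in _ +i* X](H ('i *: to_hardy gH)).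
Qed.
End InnerFunction.

(** * The theorem *)

Section PositiveOperators.
Context (R : realType).
Local Notation L2 := (L2 R).
Local Notation hardy := (hardy R).
Local Notation r := (@hardy_inner R).
Let hH := @hardy_hilbert R.

Lemma to_hardyK (f : hardy) (fH : H2 R f) : to_hardy fH = f.
Proof. exact/val_inj. Qed.

Definition extend_hardy (A : hardy -> hardy) (f : L2) : L2 :=
  if pselect (H2 R f) is left fH then hardy_val (A (to_hardy fH)) else 0.

Lemma extend_hardyE A (f : hardy) : extend_hardy A f = A f.
Proof.
by rewrite /extend_hardy; case: pselect => [fH|]; [rewrite to_hardyK|case; exact: hardyP].
Qed.

Lemma extend_hardy_positive (A : {linear hardy -> hardy}) (c : R) :
  (forall f g, r (A f) g = r f (A g)) -> (forall f, 0 <= r (A f) f) ->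
  (forall f, Num.sqrt (r (A f) (A f)) <= c * Num.sqrt (r f f)) ->
  positive_operator (H2 R) (extend_hardy A).
Proof.
move=> A_sym A_ge0 A_le; split; first split.
- by move=> f fH; rewrite -[f]/(hardy_val (to_hardy fH)) extend_hardyE; exact: hardyP.
- move=> a f g fH gH; rewrite -[f]/(hardy_val (to_hardy fH)) -[g]/(hardy_val (to_hardy gH)).
  by rewrite -hardy_valZ -hardy_valD !extend_hardyE linearP.
- by exists c => f fH; rewrite -[f]/(hardy_val (to_hardy fH)) extend_hardyE; exact: A_le.
move=> f fH; rewrite -[f]/(hardy_val (to_hardy fH)) extend_hardyE.
move: (to_hardy fH) => {fH}f.
rewrite inner_re lecE /= -[re_inner _ f]/(r (A f) f) A_ge0 andbT; apply/eqP.
(* The imaginary part of <A f, f> is Re <A f, i f>; symmetry of A and skewness of i make it equal to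
   its opposite. *)
have := A_sym f ('i *: f).
rewrite linearZZ [r f _](hilbertC hH) (ripiC hH) => h.
have {}h : r (A f) ('i *: f) = 0 by lra.
exact: h.
Qed.

(** Polarization: for h = i g + f, the imaginary part of <S h, h> vanishes, which equates Re <S g,
    f> and Re <S f, g>. *)
Lemma positive_symmetric (S : L2 -> L2) : positive_operator (H2 R) S ->
  forall f g : hardy, re_inner (S f) g = re_inner f (S g).
Proof.
move=> [[_ S_lin _] S_ge0] f g.
have Im0 (h : hardy) : complex.Im (inner (S h) h) = 0.
  by apply: ger0_Im; apply: S_ge0; exact: hardyP.
have := Im0 ('i *: g + f).
rewrite hardy_valD hardy_valZ S_lin; try exact: hardyP.
rewrite !(innerDl, innerDr, innerZl, innerZr) /re_inner [inner f _]inner_conj.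
have := Im0 f; have := Im0 g.
case: (inner (S g) g) (inner (S g) f) (inner (S f) g) (inner (S f) f) =>
  [a1 a2] [b1 b2] [c1 c2] [d1 d2].
by rewrite /=; lra.
Qed.
End PositiveOperators.

(** * The de Branges-Rovnyak space of the symbol *)

Section Main.
Context (R : realType) (I : R -> R[i]) (n : nat) (inner_I : inner_function I).
Local Notation L2 := (L2 R).
Local Notation hardy := (hardy R).
Local Notation r := (@hardy_inner R).
Local Notation V := (inner_shift inner_I).
Local Notation W := (inner_coshift inner_I).
Local Notation b := (symbol I n).
Let hH := @hardy_hilbert R.
Let V_adj := inner_shift_adj inner_I.
Let V_isometry := inner_shift_isometry inner_I.

Let D (f : L2) : L2 := f - toeplitz b (toeplitz (fun t => (b t)^*) f).

Lemma defect_sqr_hardy (f : hardy) :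
  D f = hardy_val (f - symbol_op V n (symbol_adj W n f)).
Proof.
by rewrite /D (symbol_toeplitz_conj n inner_I) (symbol_toeplitz n inner_I).
Qed.

(** The root built by iteration shows that a root exists; this makes the choice behind [defect]
    satisfy its specification, from which the sequel works. *)
Lemma defect_spec : positive_operator (H2 R) (defect b) /\
  forall f, H2 R f -> defect b (defect b f) = D f.
Proof.
have [A [A_sym A_ge0 A_le AA]] := sqrt_symbol_defect hH n V_adj V_isometry.
apply: (@xgetPex _ (fun=> 0) [set A : L2 -> L2 | positive_operator (H2 R) A /\
  forall f, H2 R f -> A (A f) = D f]).
exists (extend_hardy A); split; first exact: extend_hardy_positive A_le.
move=> f fH; rewrite -[f]/(hardy_val (to_hardy fH)) !extend_hardyE AA.
by rewrite defect_sqr_hardy.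
Qed.

Let defect_H2 (f : hardy) : H2 R (defect b f).
Proof. by have [[[+ _ _] _] _] := defect_spec; apply; exact: hardyP. Qed.

Definition defect_hardy_fun (f : hardy) : hardy := to_hardy (defect_H2 f).

Lemma defect_hardy_linear : linear defect_hardy_fun.
Proof.
move=> a f g; apply/val_inj; have [[[_ dl _] _] _] := defect_spec.
rewrite -[LHS]/(defect b (hardy_val (a *: f + g))) -[RHS]/(a *: defect b f + defect b g).
by rewrite hardy_valD hardy_valZ dl//; exact: hardyP.
Qed.

Definition defect_hardy : {linear hardy -> hardy} := linear_pack defect_hardy_linear.
Local Notation A := defect_hardy.

Lemma defect_hardyE (f : hardy) : defect b f = A f. Proof. by []. Qed.

Lemma defect_hardy_sym f g : r (A f) g = r f (A g).
Proof. by have [dp _] := defect_spec; exact: (positive_symmetric dp). Qed.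

Lemma defect_hardy_sqr f : A (A f) = f - symbol_op V n (symbol_adj W n f).
Proof.
apply/val_inj; have [_ dd] := defect_spec.
by rewrite -[LHS]/(defect b (defect b f)) dd; [exact: defect_sqr_hardy|exact: hardyP].
Qed.

Lemma dBR_hardy (f : hardy) : dBR b f <-> exists x, A x = f.
Proof.
split=> [[x xH xf]|[x <-]]; last by exists x => //; exact: hardyP.
by exists (to_hardy xH); exact/val_inj.
Qed.

(** [dBR_lift] chooses from a nonempty set: projecting a preimage onto the closure of the range
    keeps its image and makes it orthogonal to the kernel. *)
Lemma dBR_lift_spec (f : hardy) : (exists x, A x = f) ->
  exists x : hardy, [/\ dBR_lift b f = x, A x = f & orth_ker r A x].
Proof.
move=> [x0 Ax0]; rewrite /dBR_lift; set P := [set _ | _].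
have [x P_x] : exists x, P x.
  have [x [u [Aux Ax]]] := closed_range_lift hH defect_hardy_sym x0.
  exists x; split; last by rewrite defect_hardyE Ax Ax0.
  split; first exact: hardyP.
  have xK := converges_range_orth hH defect_hardy_sym Aux.
  apply: (@inner_eq0P _ [set g | H2 R g /\ defect b g = 0]) => [a z [zH Sz]|z [zH Sz]].
  - split; first by rewrite -[_ *: _]addr0; apply: H2_linear => //; exact: H2_0.
    rewrite -[z]/(hardy_val (to_hardy zH)) -hardy_valZ defect_hardyE linearZZ hardy_valZ.
    by rewrite -defect_hardyE Sz scaler0.
  - by apply: (xK (to_hardy zH)); exact/val_inj.
have [[xH xK] Sx] := xgetPex 0 (ex_intro _ _ P_x).
exists (to_hardy xH); split => //; first exact/val_inj.
move=> y Ay0; rewrite /hardy_inner /re_inner xK//; split; first exact: hardyP.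
by rewrite defect_hardyE Ay0.
Qed.

Lemma dBR_decomposition (f : hardy) : dBR b f <->
  exists h k, W k = 0 /\ f = (h - V h) + kernel_op V n k.
Proof.
apply: (iff_trans (dBR_hardy f)).
exact: (range_decomposition hH V_adj V_isometry defect_hardy_sym defect_hardy_sqr).
Qed.

Lemma dBR_orthogonal (h k : hardy) : W k = 0 ->
  dBR_inner b (hardy_val (h - V h)) (hardy_val (kernel_op V n k)) = 0.
Proof.
move=> Wk0; have V0 : kernel_op V n 0 = 0 := linear0 (linear_pack (kernel_op_linear hH V n)).
have kerZ c x : kernel_op V n (c *: x) = c *: kernel_op V n x :=
  linearZZ (linear_pack (kernel_op_linear hH V n)) c x.
have [|x1 [lift1 Ax1 _]] := @dBR_lift_spec (h - V h).
  by apply/dBR_hardy/dBR_decomposition; exists h, 0; rewrite linear0 V0 addr0.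
have [|x2 [lift2 Ax2 x2K]] := @dBR_lift_spec (kernel_op V n k).
  by apply/dBR_hardy/dBR_decomposition; exists 0, k; rewrite linear0 subr0 add0r.
have orthP y k' := @range_orthogonal _ _ _ hH V W n V_adj V_isometry A
  defect_hardy_sym defect_hardy_sqr x1 y h k'.
rewrite /dBR_inner lift1 lift2 inner_re -hardy_valZ.
have -> : re_inner x1 x2 = 0 := orthP x2 k x2K Wk0 Ax1 Ax2.
(* The imaginary part is the real statement for i k, since i x2 is the lift of p(V)(i k). *)
have -> : re_inner x1 (hardy_val ('i *: x2)) = 0; last by [].
apply: (orthP ('i *: x2) ('i *: k)) => //; last by rewrite linearZZ Ax2 kerZ.
  by move=> y Ay0; rewrite (ripiC hH) x2K ?oppr0// linearZZ Ay0 scaler0.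
by rewrite linearZZ Wk0 scaler0.
Qed.
End Main.

Theorem theorem1 (R : realType) (I : R -> R[i]) (n : nat)
    (inner_I : inner_function I) :
  dBR_orth_sum (fun t : R => I t ^+ n * (1 + I t) / 2)
    (mult_set (fun t : R => 1 - I t) (H2 R))
    (mult_set (fun t : R => 2 * (\sum_(j < n) I t ^+ j) + I t ^+ n)
              (model_space I)).
Proof.
have hH := @hardy_hilbert R.
set V := inner_shift inner_I; set W := inner_coshift inner_I.
have E1P f : mult_set (fun t : R => 1 - I t) (H2 R) f <->
    exists h : hardy R, f = h - V h.
  split=> [[h hH2 <-]|[h ->]]; last by exists h; [exact: hardyP|exact: one_sub_mult].
  by exists (to_hardy hH2); rewrite -(one_sub_mult inner_I).
have E2P f : mult_set (fun t : R => 2 * (\sum_(j < n) I t ^+ j) + I t ^+ n)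
    (model_space I) f <-> exists k : hardy R, W k = 0 /\ f = kernel_op V n k.
  split=> [[k kI <-]|[k [Wk0 ->]]].
    exists (to_hardy kI.1); rewrite -(kernel_mult n inner_I); split => //.
    exact/(model_spaceP inner_I).
  by exists k; [exact/(model_spaceP inner_I)|exact: kernel_mult].
have kernel0 : kernel_op V n 0 = 0 := linear0 (linear_pack (kernel_op_linear hH V n)).
have dP f := @dBR_decomposition R I n inner_I f.
split.
- move=> _ /E1P[h ->]; apply/dP; exists h, 0.
  by rewrite linear0 kernel0 addr0.
- move=> _ /E2P[k [Wk0 ->]]; apply/dP; exists 0, k.
  by rewrite linear0 subr0 add0r.
- apply/seteqP; split=> f.
    move=> /[dup] [[x xH <-]] fD.
    (* An element of [dBR] is a value of the defect operator, hence lies in [H2], where the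
       decomposition is available. *)
    pose g := defect_hardy n inner_I (to_hardy xH).
    have /dP[h [k [Wk0 gE]]] : dBR (symbol I n) g by exists x.
    exists (hardy_val (h - V h)); first by apply/E1P; exists h.
    exists (hardy_val (kernel_op V n k)); first by apply/E2P; exists k.
    by rewrite -hardy_valD -gE.
  move=> [_ /E1P[h ->] [_ /E2P[k [Wk0 ->]] <-]].
  by rewrite -hardy_valD; apply/dP; exists h, k.
- by move=> _ _ /E1P[h ->] /E2P[k [Wk0 ->]]; exact: dBR_orthogonal.
Qed.
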